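(* Let $K\subset K'\subset\mathbb{Z}^2$ with $K'$ finite. There exists a unique finite measure $\nu^{K,K'}$ on $(W^*,\mathcal{W}^* )$ such that $$1_{W_A^*}\,\nu^{K,K'}=\pi^*\circ Q_A^{K,K'},\qquad\text{for all }A\text{ with }K\subset A\subset K'.$$
   Context: Random walk. $P_x$ is the law of the continuous-time symmetric simple random walk $(X_t)_{t\ge0}$ on $\mathbb{Z}^2$ with exponential holding times of parameter $1$, started at $x$. For $A\subset\mathbb{Z}^2$, $H_A$ is the entrance time of $A$ (first time $t\ge 0$ at which $X_t\in A$), with $H_\emptyset=\infty$, $\widetilde H_A$ is the hitting time of $A$ (first time after the first jump at which $X_t\in A$), and $T_A=H_{\mathbb{Z}^2\setminus A}$ is the exit time from $A$. Trajectories. Let $x_*\notin\mathbb{Z}^2$ be a cemetery point; a killed trajectory reaches $x_*$ upon being killed and remains there forever. $W$ (resp. $W^+$) is the space of bi-infinite (resp. infinite) $\mathbb{Z}^2\cup\{x_*\}$-valued right-continuous trajectories (left-continuous at negative times in the bi-infinite case) whose forward and backward parts make finitely many jumps before reaching $x_*$ and from then on remain equal to $x_*$; $W$ and $W^+$ also include the $\mathbb{Z}^2$-valued trajectories (with no killing) escaping all finite sets in finite time (for $W$, separately for the forward and the backward part). $\mathcal{W},\mathcal{W}^+$ are the canonical $\sigma$-algebras, $W^*$ is the quotient of $W$ modulo time-shift, $\pi^*:W\to W^*$ is the canonical projection, and $\mathcal{W}^*$ is the induced $\sigma$-algebra. $W_A\subset W$ is the set of trajectories entering $A$, and $W_A^*=\pi^*(W_A)$.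 For a measure $\mu$, $1_B\,\mu=\mu(\,\cdot\cap B)$ is its restriction to $B$, and $\pi^*\circ Q$ is the image of $Q$ under $\pi^*$. The measures $Q_A^{K,K'}$. For $K\subset A\subset K'$, let $\rho_A^{K,K'}(x)=P_x[\widetilde H_A>T_{K'}]\,P_x[H_K>T_{K'}]\,1_A(x)$, $x\in\mathbb{Z}^2$. $Q_A^{K,K'}$ is the measure on $(W,\mathcal{W})$, supported on $W_A$ (in fact on trajectories entering $A$ at time $0$), given for $E^-,E^+\in\mathcal{W}^+$ and $x\in A$ by $$Q_A^{K,K'}[(X_{-t})_{t\ge0}\in E^-,\,X_0=x,\,(X_t)_{t\ge0}\in E^+]=P_x[(X_t)_{0\le t\le T_{K'}}\in E^-\,|\,\widetilde H_A>T_{K'}]\;\rho_A^{K,K'}(x)\;P_x[(X_t)_{0\le t\le T_{K'}}\in E^+\,|\,H_K>T_{K'}],$$ where on the right-hand side the walk is killed (sent to $x_*$) upon exiting $K'$; equivalently, the right-hand side is $P_x[(X_t)_{0\le t\le T_{K'}}\in E^-,\,\widetilde H_A>T_{K'}]\,P_x[(X_t)_{0\le t\le T_{K'}}\in E^+,\,H_K>T_{K'}]$.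
   Formalization: Uniqueness is among finite measures carried by W^*_{K'} (the equations ignore trajectories avoiding K'); in Q_A the backward part starts at X_{0-}, after the walk's first jump, so the holding time at X_0 is not counted twice and A is entered exactly at time 0. *)

(* Defs.v *)
From HB Require Import structures.
From mathcomp Require Import all_boot all_order all_algebra generic_quotient.
From mathcomp Require Import all_classical all_reals all_analysis.

Set Implicit Arguments.
Unset Strict Implicit.
Unset Printing Implicit Defensive.
Import Order.TTheory GRing.Theory Num.Theory.
From mathcomp Require Import lra.
Import numFieldNormedType.Exports.
Local Open Scope classical_set_scope.
Local Open Scope ring_scope.
Local Open Scope quotient_scope.

Notation Z2 := (int * int)%type.

(* The state space Z^2 together with the cemetery x_* = None. *)
Notation state := (option Z2).

Definition inside (A : set Z2) (z : state) : Prop := exists2 y, A y & z = Some y.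

Section Trajectories.
Context (R : realType).
Implicit Types (f : {nonneg R} -> state) (w : R -> state).

Definition rcont f := forall t : {nonneg R},
  exists2 e : R, 0 < e &
    forall s : {nonneg R}, t%:num <= s%:num < t%:num + e -> f s = f t.

(* Z^2 u {x_*} is discrete, so a jump is a point where f is not locally
   constant. *)
Definition jumps f := [set t : {nonneg R} |
  ~ exists2 e : R, 0 < e &
      forall s : {nonneg R}, `|s%:num - t%:num| < e -> f s = f t].

Definition killed_traj f :=
  (exists T : {nonneg R}, forall t : {nonneg R},
     f t = None <-> T%:num <= t%:num)
  /\ finite_set (jumps f).

Definition escaping_traj f :=
  (forall t, f t <> None) /\
  forall F : set Z2, finite_set F ->
    exists T : R, forall t : {nonneg R}, T <= t%:num -> ~ inside F (f t).

Definition Wplus_pred : set ({nonneg R} -> state) :=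
  [set f | rcont f /\ (killed_traj f \/ escaping_traj f)].

Definition left_lim w (t : R) : state :=
  xget None [set z | \forall u \near t^'-, w u = z].

Definition forward w : {nonneg R} -> state := fun t => w t%:num.

(* The reversed trajectory t |-> X_{-t}, with value X_{0-} at t = 0: elements
   of W are left-continuous at negative times only, and may jump at time 0. *)
Definition backward w : {nonneg R} -> state :=
  fun t => if t%:num == 0 then left_lim w 0 else w (- t%:num).

Definition W_pred : set (R -> state) :=
  [set w | Wplus_pred (forward w) /\ Wplus_pred (backward w)].

(* w' is w(s + .), normalised to be right-continuous on [0, oo[ and
   left-continuous on ]-oo, 0[ as elements of W are. *)
Definition is_shift (s : R) w w' :=
  (forall t, 0 <= t -> \forall u \near t^'+, w (s + u) = w' t) /\
  (forall t, t < 0 -> \forall u \near t^'-, w (s + u) = w' t).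

Definition shift_eqb (w w' : W_pred) : bool :=
  `[< exists s, is_shift s (val w) (val w') >].

(* The measurable structures below need inhabited types. *)
Lemma cemetery_Wplus : Wplus_pred (fun=> None).
Proof.
split; first by move=> t; exists 1.
left; split; first by exists 0%:nng => t; split=> // _; exact: ge0.
rewrite [jumps _](_ : _ = set0)//.
by rewrite -subset0 => t /=; apply; exists 1.
Qed.

Lemma cemetery_W : W_pred (fun=> None).
Proof.
split; first exact: cemetery_Wplus.
rewrite [backward _](_ : _ = fun=> None); first exact: cemetery_Wplus.
apply/funext => t; rewrite /backward; case: ifP => // _.
rewrite /left_lim; case: xgetP => // z _ /= zE.
by have [u ->] := @filter_ex _ (0 : R)^'- _ _ zE.
Qed.

Let side (t e u : R) := if 0 <= t then t < u < t + e else t - e < u < t.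

Let near_side (t : R) (Q : R -> Prop) :
  (if 0 <= t then \forall u \near t^'+, Q u else \forall u \near t^'-, Q u) <->
  exists2 e : R, 0 < e & forall u, side t e u -> Q u.
Proof.
rewrite /side; case: ifPn => _; split.
- case => e /= e0 eQ; exists e => // u /andP[tu ue]; apply: eQ => //=.
  by rewrite ltr_distlC; apply/andP; split => //; lra.
- case=> e e0 eQ; near=> u; apply: eQ; apply/andP; split => //.
  by near: u; apply: nbhs_right_lt; rewrite ltrDl.
- case => e /= e0 eQ; exists e => // u /andP[tu ue]; apply: eQ => //=.
  by rewrite ltr_distlC; apply/andP; split => //; lra.
- case=> e e0 eQ; near=> u; apply: eQ; apply/andP; split => //.
  by near: u; apply: nbhs_left_gt; rewrite gtrBl.
Unshelve. all: by end_near. Qed.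

Let side_pt (t e a b : R) : 0 < e -> a < t < b ->
  exists2 q, side t e q & a < q < b.
Proof.
move=> e0 /andP[at_ tb]; rewrite /side; case: (0 <= t).
- exists (t + Num.min e (b - t) / 2).
    by case: (leP e (b - t)) => h; apply/andP; split; lra.
  by case: (leP e (b - t)) => h; apply/andP; split; lra.
- exists (t - Num.min e (t - a) / 2).
    by case: (leP e (t - a)) => h; apply/andP; split; lra.
  by case: (leP e (t - a)) => h; apply/andP; split; lra.
Qed.

Let side_open (t e : R) :
  exists a b : R, forall u, side t e u = (a < u < b).
Proof.
by rewrite /side; case: (0 <= t); [exists t, (t + e)|exists (t - e), t].
Qed.

Let is_shiftE (s : R) w w' : is_shift s w w' <->
  forall t, exists2 e, 0 < e & forall u, side t e u -> w (s + u) = w' t.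
Proof.
split=> [[h1 h2] t|h].
  apply/(near_side t (fun u => w (s + u) = w' t)).
  by case: ifPn => [/h1//|]; rewrite -ltNge => /h2.
by split=> t t0; have /near_side := h t; [rewrite t0|rewrite leNgt t0].
Qed.

Let W_side (w : W_pred) (t : R) :
  exists2 e, 0 < e & forall u, side t e u -> val w u = val w t.
Proof.
case: w => /= w; rewrite inE => -[[rc _] [lc _]].
case: (leP 0 t) => t0.
- have [e e0 he] := rc (NngNum t0); exists e => // u.
  rewrite /side t0 => /andP[tu ue].
  have u0 : 0 <= u by lra.
  by have := he (NngNum u0); apply; apply/andP; split => //=; lra.
- have nt0 : 0 <= - t by lra.
  have [e e0 he] := lc (NngNum nt0); exists (Num.min e (- t)).
    by rewrite lt_min e0 oppr_gt0.
  move=> u; rewrite /side leNgt t0 /= => /andP[tu ut].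
  have u0 : 0 <= - u by lra.
  have := he (NngNum u0); rewrite /backward /= !opprK.
  rewrite !oppr_eq0 (lt_eqF t0) (lt_eqF (lt_trans ut t0)); apply.
  have : Num.min e (- t) <= e by rewrite ge_min lexx.
  by move=> h; apply/andP; split; lra.
Qed.

Let shift_const (s a b : R) (w : W_pred) w' c : is_shift s (val w) w' ->
  (forall u, a < u < b -> w' u = c) -> forall u, a < u < b -> val w (s + u) = c.
Proof.
move=> /is_shiftE sh w'c u uab.
have [e e0 he] := W_side w (s + u).
have [p /[dup] psu /he <- pab] : exists2 p, side (s + u) e p & s + a < p < s + b.
  by apply: side_pt => //; move: uab => /andP[? ?]; apply/andP; split; lra.
have [a1 [b1 ab1]] := side_open (s + u) e.
have psab : a < p - s < b by move: pab => /andP[? ?]; apply/andP; split; lra.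
have [e' e'0 he'] := sh (p - s).
have [q qs qab] : exists2 q, side (p - s) e' q & a1 - s < q < b1 - s.
  apply: side_pt => //; move: psu; rewrite ab1 => /andP[? ?].
  by apply/andP; split; lra.
rewrite -(w'c _ psab) -(he' _ qs) (he _ psu) -(he (s + q))// ab1.
by move: qab => /andP[? ?]; apply/andP; split; lra.
Qed.

Lemma shift_equiv : equiv_class_of shift_eqb.
Proof.
split.
- move=> w; apply/asboolP; exists 0; apply/is_shiftE => t.
  by have [e e0 he] := W_side w t; exists e => // u; rewrite add0r => /he.
- move=> w1 w2.
  suff sym (w w' : W_pred) : shift_eqb w w' -> shift_eqb w' w.
    by apply/idP/idP; exact: sym.
  move=> /asboolP[s /is_shiftE sh]; apply/asboolP; exists (- s).
  apply/is_shiftE => t.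
  have [e e0 he] := W_side w t; exists e => // u tu.
  have [a [b ab]] := side_open t e.
  have [e' e'0 he'] := sh (- s + u).
  have [q qs qab] : exists2 q, side (- s + u) e' q & a - s < q < b - s.
    by apply: side_pt => //; move: tu; rewrite ab => /andP[? ?];
      apply/andP; split; lra.
  rewrite -(he' _ qs); apply: he; rewrite ab.
  by move: qab => /andP[? ?]; apply/andP; split; lra.
- move=> w2 w1 w3 /asboolP[s sh] /asboolP[s' /is_shiftE sh'].
  apply/asboolP; exists (s + s'); apply/is_shiftE => t.
  have [e e0 he] := sh' t; exists e => // u tu.
  have [a [b ab]] := side_open t e; rewrite -addrA.
  apply: (shift_const (a := s' + a) (b := s' + b) sh); last first.
    by move: tu; rewrite ab => /andP[? ?]; apply/andP; split; lra.
  move=> v vab; have := he (v - s'); rewrite addrCA subrr addr0; apply.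
  by rewrite ab; move: vab => /andP[? ?]; apply/andP; split; lra.
Qed.

End Trajectories.
Arguments Wplus_pred : clear implicits.
Arguments W_pred : clear implicits.

Section Spaces.
Context (R : realType).

Definition Wplus_traj : Type := Wplus_pred R.
HB.instance Definition _ := Choice.copy Wplus_traj (Wplus_pred R).
HB.instance Definition _ := isPointed.Build Wplus_traj
  (exist (fun f => f \in Wplus_pred R) _ (mem_set (cemetery_Wplus R))).

Definition W_traj : Type := W_pred R.
HB.instance Definition _ := Choice.copy W_traj (W_pred R).
HB.instance Definition _ := isPointed.Build W_traj
  (exist (fun w => w \in W_pred R) _ (mem_set (cemetery_W R))).

(* The canonical sigma-algebras are generated by the coordinates. *)
Definition Wplus_cylinders : set (set Wplus_traj) :=
  [set C | exists t z, C = [set f | sval f t = z]].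

Definition W_cylinders : set (set W_traj) :=
  [set C | exists t z, C = [set w | sval w t = z]].

Definition Wplus := g_sigma_algebraType Wplus_cylinders.
HB.instance Definition _ := Measurable.on Wplus.

Definition W := g_sigma_algebraType W_cylinders.
HB.instance Definition _ := Measurable.on W.

Canonical shift_equiv_rel := EquivRelPack (@shift_equiv R).

Definition Wstar := {eq_quot shift_equiv_rel}.
HB.instance Definition _ := Quotient.on Wstar.
HB.instance Definition _ := Choice.on Wstar.

Definition pistar (w : W) : Wstar := \pi_Wstar w.

HB.instance Definition _ := isPointed.Build Wstar (pistar point).

(* The largest sigma-algebra making pistar measurable. *)
Definition Wstar_measurable : set (set Wstar) :=
  [set B | measurable (pistar @^-1` B)].

Let Wstar_measurable0 : Wstar_measurable set0.
Proof. by rewrite /Wstar_measurable/= preimage_set0. Qed.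

Let Wstar_measurableC B : Wstar_measurable B -> Wstar_measurable (~` B).
Proof. by rewrite /Wstar_measurable/= preimage_setC => /measurableC. Qed.

Let Wstar_measurableU (F : (set Wstar)^nat) :
  (forall n, Wstar_measurable (F n)) -> Wstar_measurable (\bigcup_n F n).
Proof.
by move=> mF; rewrite /Wstar_measurable/= preimage_bigcup; exact: bigcupT_measurable.
Qed.

HB.instance Definition _ := @isMeasurable.Build default_measure_display
  Wstar Wstar_measurable Wstar_measurable0 Wstar_measurableC Wstar_measurableU.

Definition W_enter (A : set Z2) : set W :=
  [set w | exists t : R, inside A (sval w t)].

Definition Wstar_enter (A : set Z2) : set Wstar := pistar @` W_enter A.

Definition W_enter_at0 (A : set Z2) : set W :=
  [set w | inside A (sval w 0) /\ forall t : R, t < 0 -> ~ inside A (sval w t)].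

End Spaces.

Section Walk.
Context (R : realType) (d : measure_display) (Omega : measurableType d).
Context (P : probability Omega R).
Context (step : nat -> Omega -> Z2) (hold : nat -> Omega -> R).

Definition unit_step (u : Z2) : bool := (`|u.1| + `|u.2| == 1)%N.

(* The steps are i.i.d. uniform on the four unit vectors, the holding times
   i.i.d. exponential with parameter 1, and the two families independent. *)
Definition srw_model : Prop :=
  [/\ forall k u, measurable [set o | step k o = u],
      forall k, measurable_fun [set: Omega] (hold k),
      forall k o, 0 < hold k o &
      forall (n : nat) (u : 'I_n -> Z2) (B : 'I_n -> set R),
        (forall k, measurable (B k)) ->
        P [set o | forall k : 'I_n, step k o = u k /\ B k (hold k o)] =
        (\prod_(k < n)
           ((if unit_step (u k) then 4^-1 else 0)%:E
            * exponential_prob 1 (B k)))%E].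

Definition jump_time (n : nat) (o : Omega) : R := \sum_(k < n) hold k o.

(* The walk started at x, under which P is P_x; the value None is taken at
   negative times and after an explosion (a null event), where no n fits. *)
Definition walk (x : Z2) (o : Omega) (t : R) : state :=
  xget None [set z | exists2 n,
    jump_time n o <= t < jump_time n.+1 o &
    z = Some (x + \sum_(k < n) step k o)].

(* The first time in [s, oo[ at which X is in A. *)
Definition entrance_from (s : R) (A : set Z2) (X : R -> state) : \bar R :=
  ereal_inf [set t%:E | t in [set t | s <= t /\ inside A (X t)]].

Definition entrance_time := entrance_from 0.

Definition exit_time (A : set Z2) (X : R -> state) := entrance_time (~` A) X.

Definition hitting_time (A : set Z2) (x : Z2) (o : Omega) : \bar R :=
  entrance_from (jump_time 1 o) A (walk x o).

Definition killed (K' : set Z2) (X : R -> state) (t : R) : state :=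
  if (t%:E < exit_time K' X)%E then X t else None.

(* P_x[the killed walk is in E, H_K > T_{K'}]. *)
Definition forward_mass (K K' : set Z2) (x : Z2) (E : set (Wplus R)) : \bar R :=
  P [set o | (sval @` E) (fun t : {nonneg R} => killed K' (walk x o) t%:num) /\
             (exit_time K' (walk x o) < entrance_time K (walk x o))%E].

(* P_x[the killed walk is in E, H~_A > T_{K'}], with the killed walk observed
   from its first jump on: the holding time at x belongs to the forward part
   only, so that the trajectory enters A exactly at time 0. *)
Definition backward_mass (A K' : set Z2) (x : Z2) (E : set (Wplus R)) : \bar R :=
  P [set o | (sval @` E) (fun t : {nonneg R} =>
               killed K' (walk x o) (jump_time 1 o + t%:num)) /\
             (exit_time K' (walk x o) < hitting_time A x o)%E].

(* The conditional probabilities and the weight rho_A^{K,K'}(x) of the usual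
   definition are multiplied out. Together with the first clause, the second
   one determines Q, as it covers all of W_enter_at0 A. *)
Definition is_QA (K K' A : set Z2) (Q : {measure set (W R) -> \bar R}) : Prop :=
  Q (~` W_enter_at0 A) = 0%E /\
  forall (Em Ep : set (Wplus R)) (x : Z2),
    measurable Em -> measurable Ep -> A x ->
    Q [set w | [/\ (sval @` Em) (backward (sval w)),
                   sval w 0 = Some x &
                   (sval @` Ep) (forward (sval w))]] =
    (backward_mass A K' x Em * forward_mass K K' x Ep)%E.

(* 1_{W_A^*} nu is the image of Q_A^{K,K'} under pistar, K c A c K'. *)
Definition interlacement_eq (K K' : set Z2)
    (nu : {finite_measure set (Wstar R) -> \bar R}) : Prop :=
  forall A : set Z2, K `<=` A -> A `<=` K' ->
    exists Q : {measure set (W R) -> \bar R}, is_QA K K' A Q /\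
      forall B : set (Wstar R), measurable B ->
        nu (B `&` Wstar_enter A) = pushforward Q (@pistar R) B.

End Walk.

(* Main.v *)
(* Q_A is a sum, over the finite words s = (s_0, ..., s_l) with s_0 and s_l
   outside K', all other letters in K' \ K, and at least one of them in A, of the
   law of a trajectory following s: two independent walks issued from the first
   letter of s in A trace s backwards and forwards until they leave K'. By the
   symmetry of the walk, s has weight the product of its l step probabilities and,
   given s, the holding times are i.i.d. exponential, wherever s is cut in two.
   Modulo time shift, the term of s is hence the same in Q_A and in Q_K', and Q_A
   keeps the words that meet A. So nu is the image of Q_K'. Uniqueness comes from
   the case A = K', where the product formula determines Q_K' on the pi-system of
   the rectangles of backward and forward events. *)
From HB Require Import structures.
From mathcomp Require Import all_boot all_order all_algebra generic_quotient.
From mathcomp Require Import all_classical all_reals all_analysis.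
From mathcomp Require Import measurable_realfun.
Require Import Defs.
From mathcomp Require Import zify lra.
Set Implicit Arguments.
Unset Strict Implicit.
Unset Printing Implicit Defensive.
Import Order.TTheory GRing.Theory Num.Theory.
Import numFieldNormedType.Exports.
Local Open Scope classical_set_scope.
Local Open Scope ring_scope.

(** A word with [l] steps has [l - 1] letters in [K'], each with one holding time. Cut at index [j],
    it leaves [l - j] holding times to the forward walk and [j - 1] to the backward walk: the
    holding time at the entry letter belongs to the forward walk, so the initial one of the backward
    walk is discarded and integrates to 1. This is why the count does not depend on [j]. To compare
    two cuts, each trajectory is shifted to a reference one that enters [K'] at time 0. Elements of
    [W] are right-continuous at nonnegative times and left-continuous at negative ones, so the
    shifted path may differ from the reference at its jump times. The shift relation compares values
    on one-sided neighbourhoods only and is blind to this. What remains is a comparison of laws of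
    holding times, made on one space of sequences common to all words. *)

(** * Trajectories built from a list of letters and holding times *)

Section PathTrajectory.
Context (R : realType).
Implicit Types (h : nat -> R) (y : nat -> Z2) (n k : nat) (t : R).

Definition psum h n : R := \sum_(k < n) h k.

Lemma psum0 h : psum h 0 = 0.
Proof. exact: big_ord0. Qed.

Lemma psumSl h n : psum h n.+1 = h 0%N + psum (h \o S) n.
Proof. exact: big_ord_recl. Qed.

Lemma psumSr h n : psum h n.+1 = psum h n + h n.
Proof. exact: big_ord_recr. Qed.

Lemma psumD h m n : psum h (m + n) = psum h m + psum (fun k => h (m + k)%N) n.
Proof.
by elim: n => [|n IH]; rewrite ?addn0 ?psum0 ?addr0// addnS !psumSr IH addrA.
Qed.

Lemma psum_homo h : (forall k, 0 < h k) ->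
  {homo psum h : m n / (m <= n)%N >-> m <= n}.
Proof.
move=> h0 m n /subnKC <-; rewrite psumD lerDl sumr_ge0// => k _.
exact/ltW/h0.
Qed.

Lemma psum_ge0 h n : (forall k, 0 < h k) -> 0 <= psum h n.
Proof. by move=> h0; rewrite -(psum0 h) psum_homo. Qed.

Lemma psum_lt_index h m n t : (forall k, 0 < h k) ->
  psum h m <= t -> t < psum h n -> (m < n)%N.
Proof.
move=> h0 mt tn; rewrite ltnNge; apply/negP => /(psum_homo h0) nm.
by have := lt_le_trans tn (le_trans nm mt); rewrite ltxx.
Qed.

Lemma psum_index_uniq h m n t : (forall k, 0 < h k) ->
  psum h m <= t < psum h m.+1 -> psum h n <= t < psum h n.+1 -> m = n.
Proof.
move=> h0 /andP[mt tm] /andP[nt tn]; apply/eqP;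
rewrite eqn_leq -(ltnS m) -(ltnS n).
by rewrite (psum_lt_index h0 mt tn) (psum_lt_index h0 nt tm).
Qed.

Lemma psum_locate h n t : 0 <= t -> t < psum h n ->
  exists2 k, (k < n)%N & psum h k <= t < psum h k.+1.
Proof.
move=> t0; elim: n => [|n IH]; first by rewrite psum0 ltNge t0.
move=> tn; have [tn'|nt] := ltP t (psum h n); last by exists n; rewrite ?nt.
by have [k kn kt] := IH tn'; exists k => //; exact: ltnW.
Qed.

(** The recursion on the number of letters lets measurability be proved by induction; [path_traj_in]
    and [path_traj_dead] recover the description by partial sums. *)
Fixpoint path_traj n y h t : state :=
  if n is n'.+1 then
    if t < h 0%N then Some (y 0%N)
    else path_traj n' (y \o S) (h \o S) (t - h 0%N)
  else None.

Lemma eq_path_traj n y y' h h' t : (forall k, (k < n)%N -> y k = y' k) ->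
  (forall k, (k < n)%N -> h k = h' k) ->
  path_traj n y h t = path_traj n y' h' t.
Proof.
elim: n y y' h h' t => //= n IH y y' h h' t yy hh; rewrite yy// hh//.
by case: ifP => // _; apply: IH => k kn /=; [apply: yy|apply: hh].
Qed.

Lemma path_traj_in n y h t k : (forall k, 0 < h k) -> (k < n)%N ->
  psum h k <= t < psum h k.+1 -> path_traj n y h t = Some (y k).
Proof.
elim: n y h t k => // n IH y h t [|k] h0 kn /=.
  by rewrite psumSr psum0 add0r => /andP[_ ->].
rewrite (psumSl _ k) (psumSl _ k.+1) => /andP[kt tk].
have hk := psum_ge0 k (fun i => h0 i.+1).
have -> : (t < h 0%N) = false by apply/negbTE; rewrite -leNgt; lra.
rewrite (IH _ _ _ k)//; first by move=> i; exact: h0.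
by apply/andP; split; lra.
Qed.

Lemma path_traj_dead n y h t : (forall k, 0 < h k) -> psum h n <= t ->
  path_traj n y h t = None.
Proof.
elim: n y h t => // n IH y h t h0; rewrite psumSl => nt /=.
have hn := psum_ge0 n (fun i => h0 i.+1).
have -> : (t < h 0%N) = false by apply/negbTE; rewrite -leNgt; lra.
by apply: IH => [k|]; [exact: h0|lra].
Qed.

Lemma path_traj_NoneP n y h t : (forall k, 0 < h k) -> 0 <= t ->
  path_traj n y h t = None <-> psum h n <= t.
Proof.
move=> h0 t0; split; last exact: path_traj_dead.
have [//|/(psum_locate t0)[k kn kt]] := leP.
by rewrite (path_traj_in _ h0 kn kt).
Qed.

Lemma path_traj_drop m n y h t : (forall k, 0 < h k) -> 0 <= t ->
  path_traj (m + n) y h (psum h m + t) =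
  path_traj n (fun k => y (m + k)%N) (fun k => h (m + k)%N) t.
Proof.
move=> h0 t0; have [tn|nt] := leP (psum (fun k => h (m + k)%N) n) t.
  by rewrite !path_traj_dead// psumD lerD2l.
have [k kn /andP[kt tk]] := psum_locate t0 nt.
rewrite (@path_traj_in _ _ _ _ (m + k)%N) ?ltn_add2l//; last first.
  by rewrite -addnS !psumD lerD2l ltrD2l kt.
by rewrite (path_traj_in _ _ kn)// kt.
Qed.

(* Seen backwards, the path is left-continuous, whence the exclusion of its
   jump times. *)
Lemma path_traj_rev n y y' h h' t :
  (forall k, 0 < h k) -> (forall k, 0 < h' k) ->
  (forall k, (k < n)%N -> y k = y' (n - k.+1)%N) ->
  (forall k, (k < n)%N -> h k = h' (n - k.+1)%N) ->
  0 <= t < psum h n -> (forall k, (k < n)%N -> t <> psum h k) ->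
  path_traj n y h t = path_traj n y' h' (psum h n - t).
Proof.
move=> h0 h'0 yy hh /andP[t0 tn] tne.
have [k kn /andP[kt tk]] := psum_locate t0 tn.
(* Jump times counted from the two ends add up to the total duration. *)
have revE i : (i <= n)%N -> psum h i = psum h n - psum h' (n - i).
  elim: i => [|i IH] ile.
    rewrite subn0 psum0; apply/esym/eqP; rewrite subr_eq0; apply/eqP.
    rewrite /psum (reindex_inj rev_ord_inj); apply: eq_bigr => i _.
    by rewrite hh ?ltn_ord//= subnSK// subKn// ltnW.
  rewrite psumSr IH ?(ltnW ile)// hh// -(subnSK ile) psumSr; lra.
rewrite (path_traj_in _ h0 kn) ?kt// yy//; apply/esym.
apply: path_traj_in => //; first by rewrite ltn_subrL; case: n kn {tn tne yy hh revE}.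
have := revE k (ltnW kn); have := revE k.+1 kn; rewrite subnSK// => e1 e2.
have kt' : psum h k < t.
  by rewrite lt_neqAle kt andbT; apply/eqP => /esym; exact: tne.
by apply/andP; split; lra.
Qed.

Lemma path_traj_Wplus n y h : (forall k, 0 < h k) ->
  Wplus_pred R (fun t : {nonneg R} => path_traj n y h t%:num).
Proof.
move=> h0.
have const (t : {nonneg R}) : exists2 e : R, 0 < e & forall s : {nonneg R},
    t%:num <= s%:num < t%:num + e ->
    path_traj n y h s%:num = path_traj n y h t%:num.
  have [nt|/(psum_locate (ge0 t))[k kn /andP[kt tk]]] := leP (psum h n) t%:num.
    exists 1 => // s /andP[ts _].
    by rewrite !path_traj_dead// (le_trans nt).
  exists (psum h k.+1 - t%:num) => [|s /andP[ts st]]; first by rewrite subr_gt0.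
  rewrite !(path_traj_in _ h0 kn)//; first by rewrite kt.
  by apply/andP; split; lra.
split=> //; left; split.
  by exists (NngNum (psum_ge0 n h0)) => t; exact: path_traj_NoneP.
(* Every jump is one of the [n + 1] partial sums: at any other time the path is constant on the left
   as well as on the right. *)
apply: (@sub_finite_set _ _
    [set NngNum (psum_ge0 k h0) | k in [set k | (k < n.+1)%N]]); last first.
  exact/finite_image/finite_II.
move=> t /= jt; apply: contrapT => nt; apply: jt.
have tne k : (k <= n)%N -> t%:num != psum h k.
  by move=> kn; apply/eqP => tk; apply: nt; exists k => //; exact/val_inj.
have [e e0 he] := const t.
have [e' e'0 he'] : exists2 e' : R, 0 < e' & forall s : {nonneg R},
    t%:num - e' < s%:num < t%:num ->
    path_traj n y h s%:num = path_traj n y h t%:num.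
  have [nt'|/(psum_locate (ge0 t))[k kn /andP[kt tk]]] := leP (psum h n) t%:num.
    exists (t%:num - psum h n).
      by rewrite subr_gt0 lt_neqAle eq_sym tne.
    move=> s /andP[s1 s2]; rewrite !path_traj_dead//; lra.
  exists (t%:num - psum h k).
    by rewrite subr_gt0 lt_neqAle eq_sym tne// ltnW.
  move=> s /andP[s1 s2]; rewrite !(path_traj_in _ h0 kn)//; first by rewrite kt.
  by apply/andP; split; lra.
exists (Num.min e e'); first by rewrite lt_min e0.
move=> s; rewrite ltr_norml lt_min => /andP[s1 /andP[s2 s3]].
have [ts|st] := leP t%:num s%:num; first by apply: he; rewrite ts/=; lra.
apply: he'; rewrite st andbT.
have : Num.min e e' <= e' by rewrite ge_min lexx orbT.
lra.
Qed.

(* Nonpositive holding times are replaced by 1 to make the map total. *)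
Definition hpos h k : R := if 0 < h k then h k else 1.

Lemma hpos_gt0 h k : 0 < hpos h k.
Proof. by rewrite /hpos; case: ifPn. Qed.

Lemma hposE h : (forall k, 0 < h k) -> hpos h = h.
Proof. by move=> h0; apply/funext => k; rewrite /hpos h0. Qed.

Definition path_Wplus n y h : Wplus R :=
  exist (fun u => u \in Wplus_pred R) _
    (mem_set (path_traj_Wplus n y (hpos_gt0 h))).

Lemma eq_path_Wplus n y y' h h' : (forall k, (k < n)%N -> y k = y' k) ->
  (forall k, (k < n)%N -> h k = h' k) -> path_Wplus n y h = path_Wplus n y' h'.
Proof.
move=> yy hh; apply/val_inj/funext => t; apply: eq_path_traj => //= k kn.
by rewrite /hpos hh.
Qed.

End PathTrajectory.

(** * Gluing a backward and a forward part; trajectories modulo shift *)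

Section Gluing.
Context (R : realType).
Implicit Types (f : Wplus R) (w : W R) (t : R).

Definition nng_abs t : {nonneg R} := NngNum (normr_ge0 t).

Lemma nng_absE (t : {nonneg R}) : nng_abs t%:num = t.
Proof. by apply/val_inj; rewrite /= ger0_norm. Qed.

Lemma nng_absN t : nng_abs (- t) = nng_abs t.
Proof. by apply/val_inj; rewrite /= normrN. Qed.

Lemma Wplus_rcont f : rcont (sval f).
Proof. by case: f => f /=; rewrite inE => -[]. Qed.

(** Time 0 is given to the forward part; the value of [fm] at 0 survives only as the left limit at
    0. Reversing time turns the right-continuity of [fm] into left-continuity. *)
Definition glue_fun (fm fp : Wplus R) t : state :=
  if 0 <= t then sval fp (nng_abs t) else sval fm (nng_abs t).

Lemma forward_glue fm fp : forward (glue_fun fm fp) = sval fp.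
Proof. by apply/funext => t; rewrite /forward /glue_fun ge0 nng_absE. Qed.

Lemma left_lim_eq (w : R -> state) t z :
  (\forall u \near t^'-, w u = z) -> left_lim w t = z.
Proof.
move=> wz; rewrite /left_lim; case: xgetP => [z' _ /= wz'|/(_ z)//].
by have [u []] := @filter_ex _ (t : R)^'- _ _ (filterI wz wz') => -> ->.
Qed.

Lemma backward_glue fm fp : backward (glue_fun fm fp) = sval fm.
Proof.
apply/funext => t; rewrite /backward; case: ifPn => [/eqP t0|t0]; last first.
  rewrite /glue_fun oppr_ge0 leNgt lt_neqAle eq_sym t0 ge0/=.
  by rewrite nng_absN nng_absE.
have [e e0 he] := Wplus_rcont fm t.
apply: left_lim_eq; near=> u.
have u0 : u < 0 by near: u; exact: nbhs_left_lt.
rewrite /glue_fun leNgt u0/=; apply: he => /=.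
rewrite t0 normr_ge0 add0r ltr0_norm//= ltrNl.
by near: u; apply: nbhs_left_gt; rewrite oppr_lt0.
Unshelve. all: by end_near. Qed.

Lemma glue_W fm fp : W_pred R (glue_fun fm fp).
Proof.
split; rewrite ?forward_glue ?backward_glue.
  by case: fp => f /=; rewrite inE.
by case: fm => f /=; rewrite inE.
Qed.

Definition glue fm fp : W R :=
  exist (fun u => u \in W_pred R) _ (mem_set (glue_W fm fp)).

Lemma forward_W w : Wplus_pred R (forward (sval w)).
Proof. by case: w => w /=; rewrite inE => -[]. Qed.

Lemma backward_W w : Wplus_pred R (backward (sval w)).
Proof. by case: w => w /=; rewrite inE => -[]. Qed.

Definition Fwd w : Wplus R :=
  exist (fun u => u \in Wplus_pred R) _ (mem_set (forward_W w)).

Definition Bwd w : Wplus R :=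
  exist (fun u => u \in Wplus_pred R) _ (mem_set (backward_W w)).

Lemma Fwd_glue fm fp : Fwd (glue fm fp) = fp.
Proof. by apply/val_inj; exact: forward_glue. Qed.

Lemma Bwd_glue fm fp : Bwd (glue fm fp) = fm.
Proof. by apply/val_inj; exact: backward_glue. Qed.

Lemma FwdE w t : 0 <= t -> sval w t = sval (Fwd w) (nng_abs t).
Proof. by move=> t0; rewrite /= /forward /= ger0_norm. Qed.

Lemma BwdE w t : t < 0 -> sval w t = sval (Bwd w) (nng_abs t).
Proof.
by move=> t0; rewrite /= /backward /= ltr0_norm// opprK oppr_eq0 lt_eqF.
Qed.

(** Moves events stated for bare functions, as in [is_QA] and the two masses, to elements of
    [Wplus]. *)
Lemma in_sval_image (E : set (Wplus R)) f (g : {nonneg R} -> state) :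
  sval f = g -> (sval @` E) g <-> E f.
Proof.
move=> fg; split=> [[f' Ef' f'g]|Ef]; last by exists f.
by rewrite (_ : f = f')//; apply/val_inj; rewrite /= fg.
Qed.

Lemma W_right w t : 0 <= t ->
  exists2 e : R, 0 < e & forall u, t <= u < t + e -> sval w u = sval w t.
Proof.
move=> t0; have [e e0 he] := Wplus_rcont (Fwd w) (nng_abs t).
exists e => // u /andP[tu ut]; rewrite !FwdE ?(le_trans t0)//.
by apply: he => /=; rewrite !ger0_norm ?(le_trans t0)// tu.
Qed.

Lemma W_left w t : t < 0 ->
  exists2 e : R, 0 < e & forall u, t - e < u <= t -> sval w u = sval w t.
Proof.
move=> t0; have [e e0 he] := Wplus_rcont (Bwd w) (nng_abs t).
exists e => // u /andP[tu ut]; rewrite !BwdE ?(le_lt_trans ut)//.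
by apply: he => /=; rewrite !ltr0_norm ?(le_lt_trans ut)//; apply/andP; split; lra.
Qed.

Lemma W_near_right w t : 0 <= t -> \forall u \near t^'+, sval w u = sval w t.
Proof.
move=> /(W_right w)[e e0 he]; near=> u; apply: he; apply/andP; split.
  by apply: ltW; near: u; exact: nbhs_right_gt.
by near: u; apply: nbhs_right_lt; rewrite ltrDl.
Unshelve. all: by end_near. Qed.

Lemma W_near_left w t : t < 0 -> \forall u \near t^'-, sval w u = sval w t.
Proof.
move=> /(W_left w)[e e0 he]; near=> u; apply: he; apply/andP; split.
  by near: u; apply: nbhs_left_gt; rewrite gtrBl.
by apply: ltW; near: u; exact: nbhs_left_lt.
Unshelve. all: by end_near. Qed.

(** Reduces entrance events to countable unions. The sign clause keeps a negative time negative, for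
    the event of not having entered before time 0. *)
Lemma W_rational w t : exists q : rat,
  sval w (ratr q) = sval w t /\ (t < 0 -> (ratr q : R) < 0).
Proof.
have [t0|t0] := leP 0 t.
  have [e e0 he] := W_right w t0.
  have [q] : exists q : rat, (ratr q : R) \in `]t, t + e[.
    by apply: rat_in_itvoo; rewrite ltrDl.
  rewrite in_itv/= => /andP[tq qt]; exists q; split=> //.
  by apply: he; rewrite (ltW tq).
have [e e0 he] := W_left w t0.
have [q] : exists q : rat, (ratr q : R) \in `]t - e, t[.
  by apply: rat_in_itvoo; rewrite gtrBl.
rewrite in_itv/= => /andP[tq qt]; exists q.
split; last by move=> _; exact: lt_trans t0.
by apply: he; rewrite tq (ltW qt).
Qed.

Lemma pistar_eqP w w' :
  pistar w = pistar w' <-> exists s, is_shift s (sval w) (sval w').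
Proof.
rewrite /pistar; split => [/eqmodP/asboolP//|h].
exact/eqmodP/asboolP.
Qed.

(** A value of [w'] is a one-sided limit of the shifted [w]; the states being discrete, [w] takes it
    at some nearby time. *)
Lemma shift_enter s w w' A : is_shift s (sval w) (sval w') ->
  W_enter A w' -> W_enter A w.
Proof.
move=> [h1 h2] [t Awt]; have [t0|t0] := leP 0 t.
  have [u wu] := @filter_ex _ (t : R)^'+ _ _ (h1 t t0).
  by exists (s + u); rewrite wu.
have [u wu] := @filter_ex _ (t : R)^'- _ _ (h2 t t0).
by exists (s + u); rewrite wu.
Qed.

Lemma Wstar_enterE A w : Wstar_enter A (pistar w) <-> W_enter A w.
Proof.
split=> [[w' Aw' /esym/pistar_eqP[s /shift_enter]]|Aw]; last by exists w.
exact.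
Qed.

End Gluing.

(** * Exit and entrance times of the walk in terms of its discrete skeleton *)

Section WalkPaths.
Context (R : realType) (d : measure_display) (Omega : measurableType d).
Context (step : nat -> Omega -> Z2) (hold : nat -> Omega -> R).
Context (hold_gt0 : forall k o, 0 < hold k o).
Context (K' : set Z2) (x : Z2) (o : Omega).

Local Notation jump n := (jump_time hold n o).
Local Notation X := (walk step hold x o).
Local Notation pos n := (x + \sum_(k < n) step k o).

Let hold0 k : 0 < hold k o. Proof. exact: hold_gt0. Qed.

Lemma jump_homo : {homo (fun n => jump n) : m n / (m <= n)%N >-> m <= n}.
Proof. exact: (psum_homo hold0). Qed.

Lemma walk_eq n t : jump n <= t < jump n.+1 -> X t = Some (pos n).
Proof.
move=> nt; rewrite /walk; case: xgetP => [z _ [m mt ->]|/(_ (Some (pos n)))[]].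
  by rewrite (psum_index_uniq hold0 mt nt).
by exists n.
Qed.

Lemma walk_SomeP t z : X t = Some z <->
  exists2 n, jump n <= t < jump n.+1 & z = pos n.
Proof.
split=> [|[n nt ->]]; last exact: walk_eq.
by rewrite /walk; case: xgetP => [z' _ [n nt ->] [<-]|//]; exists n.
Qed.

Lemma walk_jump n : X (jump n) = Some (pos n).
Proof.
by apply: walk_eq; rewrite lexx [jump n.+1](psumSr (hold^~ o)) ltrDl hold0.
Qed.

Definition first_exit N :=
  (forall a, (a < N)%N -> K' (pos a)) /\ ~ K' (pos N).

Lemma first_exit_uniq M N : first_exit M -> first_exit N -> M = N.
Proof.
move=> [M1 M2] [N1 N2]; have [MN|NM|//] := ltngtP M N.
  by case: (M2 (N1 _ MN)).
by case: (N2 (M1 _ NM)).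
Qed.

Lemma exit_time_eq N : first_exit N -> exit_time K' X = (jump N)%:E.
Proof.
move=> [N1 N2]; apply/eqP; rewrite eq_le; apply/andP; split.
  apply: ereal_inf_lbound; exists (jump N) => //; split.
    by rewrite -[leLHS](psum0 (hold^~ o)); exact: jump_homo.
  by exists (pos N) => //; exact: walk_jump.
apply: le_ereal_inf_tmp => _ [t [_ [z Kz /walk_SomeP[n /andP[nt _] zn]]] <-].
rewrite lee_fin (le_trans _ nt)//; apply: jump_homo.
by rewrite leqNgt; apply/negP => /N1; rewrite -zn.
Qed.

Lemma exit_time_lty : (exit_time K' X < +oo)%E -> exists N, first_exit N.
Proof.
move=> /ereal_inf_lt[_ [t [_ [z Kz /walk_SomeP[n _ zn]]] _] _].
have exN : exists n, `[< ~ K' (pos n) >].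
  by exists n; apply/asboolP; rewrite -zn.
case: (ex_minnP exN) => N /asboolP N1 N2; exists N; split=> // a aN.
apply: contrapT => Ka; have := N2 a; rewrite leqNgt aN; move/implyP.
by rewrite implybF => /negP; apply; exact/asboolP.
Qed.

Lemma lt_entrance_from N m B :
  ((jump N)%:E < entrance_from (jump m) B X)%E <->
  forall a, (m <= a <= N)%N -> ~ B (pos a).
Proof.
split=> [NB a /andP[ma aN] Ba|NB].
  move: NB; apply/negP; rewrite -leNgt.
  apply: (@le_trans _ _ (jump a)%:E); last by rewrite lee_fin; exact: jump_homo.
  apply: ereal_inf_lbound; exists (jump a) => //; split; first exact: jump_homo.
  by exists (pos a) => //; exact: walk_jump.
(* The inequality is strict because a walk avoiding [B] up to index [N] can enter it only from the
   next jump on. *)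
apply: (@lt_le_trans _ _ (jump N.+1)%:E).
  by rewrite lte_fin [jump N.+1](psumSr (hold^~ o)) ltrDl hold0.
apply: le_ereal_inf_tmp => _ [t [mt [z Bz /walk_SomeP[n /andP[nt tn] zn]]] <-].
rewrite lee_fin (le_trans _ nt)//; apply: jump_homo.
rewrite ltnNge; apply/negP => nN; apply: (NB n); last by rewrite -zn.
by rewrite nN andbT -ltnS (psum_lt_index hold0 mt tn).
Qed.

(** The strict inequality forces a finite exit time, so only finite paths are left. *)
Lemma exit_before_entranceP m B :
  (exit_time K' X < entrance_from (jump m) B X)%E <->
  exists2 N, first_exit N & forall a, (m <= a <= N)%N -> ~ B (pos a).
Proof.
split=> [lt|[N eN NB]]; last first.
  by rewrite (exit_time_eq eN); exact/lt_entrance_from.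
have [N eN] := exit_time_lty (lt_le_trans lt (leey _)).
by exists N => //; apply/lt_entrance_from; rewrite -(exit_time_eq eN).
Qed.

(** The point of index [N] lies outside [K'] and is replaced by the cemetery, which leaves [N - m]
    letters. *)
Lemma killed_path N m : first_exit N -> (m <= N)%N ->
  (fun t : {nonneg R} => killed K' X (jump m + t%:num)) =
  sval (path_Wplus (N - m) (fun k => pos (m + k)%N)
    (fun k => hold (m + k)%N o)).
Proof.
move=> eN mN; apply/funext => t; rewrite /killed (exit_time_eq eN) lte_fin.
rewrite /= hposE// -(@path_traj_drop _ m (N - m) (fun n => pos n) (hold^~ o))//.
rewrite subnKC//.
have [lt|ge] := ltP _ _; last by rewrite path_traj_dead.
have t0 : 0 <= jump m + t%:num.
  by rewrite addr_ge0// -[leLHS](psum0 (hold^~ o)); exact: jump_homo.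
have [k kN kt] := @psum_locate _ (hold^~ o) _ _ t0 lt.
by rewrite (path_traj_in _ hold0 kN)//; exact: walk_eq.
Qed.

End WalkPaths.

(** * Measurability through countable fibers *)

Section CountableFibers.
Context d (T : measurableType d).

Lemma bigcup_measurable_count (U : countType) (P : set U) (F : U -> set T) :
  (forall u, P u -> measurable (F u)) -> measurable (\bigcup_(u in P) F u).
Proof.
move=> mF; rewrite bigcup_mkcond.
apply: countable_bigcupT_measurable => [|u]; first exact: countableP.
by case: ifP => //; rewrite inE; exact: mF.
Qed.

Lemma measurable_prop (Q : Prop) : measurable [set _ : T | Q].
Proof.
have [q|q] := pselect Q; last first.
  by rewrite (_ : mkset _ = set0)//; apply/seteqP; split.
by rewrite (_ : mkset _ = setT)//; apply/seteqP; split.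
Qed.

Lemma measurable_fibers (U : countType) (f : T -> U) (Y : set U) :
  (forall u, measurable [set t | f t = u]) -> measurable [set t | Y (f t)].
Proof.
move=> mf; rewrite (_ : [set t | _] = \bigcup_(u in Y) [set t | f t = u]); last first.
  by apply/seteqP; split=> [t Yt|t [u Yu /= ->]//]; exists (f t).
exact: bigcup_measurable_count.
Qed.

End CountableFibers.

(** * Measurability on the trajectory spaces, and the rectangles *)

Section TrajectoryMeasurability.
Context (R : realType).

Lemma measurable_Wplus_coord t (z : state) :
  measurable [set f : Wplus R | sval f t = z].
Proof. by apply: sub_sigma_algebra; exists t, z. Qed.

Lemma measurable_W_coord (t : R) (z : state) :
  measurable [set w : W R | sval w t = z].
Proof. by apply: sub_sigma_algebra; exists t, z. Qed.

Lemma measurable_to_Wplus d (T : measurableType d) (g : T -> Wplus R) :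
  (forall t z, measurable [set o | sval (g o) t = z]) -> measurable_fun setT g.
Proof.
move=> mg; apply: (@measurability _ _ T (Wplus R) setT g (@Wplus_cylinders R)) => //.
by move=> _ [_ [t [z ->]] <-]; rewrite setTI; exact: mg.
Qed.

Lemma measurable_to_W d (T : measurableType d) (g : T -> W R) :
  (forall t z, measurable [set o | sval (g o) t = z]) -> measurable_fun setT g.
Proof.
move=> mg; apply: (@measurability _ _ T (W R) setT g (@W_cylinders R)) => //.
by move=> _ [_ [t [z ->]] <-]; rewrite setTI; exact: mg.
Qed.

(** The time [t] is random too, because the recursion subtracts the first holding time from it. *)
Lemma measurable_path_traj d (T : measurableType d) n (y : nat -> T -> Z2)
    (h : nat -> T -> R) (t : T -> R) z :
  (forall k u, measurable [set o | y k o = u]) ->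
  (forall k, measurable_fun setT (h k)) -> measurable_fun setT t ->
  measurable [set o | path_traj n (y^~ o) (h^~ o) (t o) = z].
Proof.
move=> my mh; elim: n => [|n IH] in y h t my mh *.
  by move=> _ /=; exact: measurable_prop.
move=> mt /=.
have mlt : measurable [set o | t o < h 0%N o].
  have := measurable_fun_ltr mt (mh 0%N) => /(_ measurableT [set true]).
  by rewrite setTI; apply.
rewrite (_ : mkset _ =
    ([set o | t o < h 0%N o] `&` [set o | [set u | Some u = z] (y 0%N o)]) `|`
    (~` [set o | t o < h 0%N o] `&`
      [set o | path_traj n ((fun k => y k.+1)^~ o) ((fun k => h k.+1)^~ o)
        (t o - h 0%N o) = z])); last first.
  apply/seteqP; split => o /=.
    by case: ifPn => ht; [left|right; split=> //; exact/negP].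
  by case=> -[]; [move=> ->|move=> /negP/negbTE ->].
apply: measurableU; apply: measurableI => //.
- exact: measurable_fibers.
- exact: measurableC.
- apply: IH => //; exact: measurable_funB.
Qed.

Lemma measurable_path_Wplus d (T : measurableType d) n (y : nat -> T -> Z2)
    (h : nat -> T -> R) :
  (forall k u, measurable [set o | y k o = u]) ->
  (forall k, measurable_fun setT (h k)) ->
  measurable_fun setT (fun o => path_Wplus n (y^~ o) (h^~ o)).
Proof.
move=> my mh; apply: measurable_to_Wplus => t z.
apply: (@measurable_path_traj _ _ n y (fun k o => hpos (h^~ o) k) (cst t%:num)) => // k.
apply: measurable_fun_ifT => //.
by apply: measurable_fun_ltr => //; exact: measurable_cst.
Qed.

Lemma measurable_glue d (T : measurableType d) (fm fp : T -> Wplus R) :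
  measurable_fun setT fm -> measurable_fun setT fp ->
  measurable_fun setT (fun o => glue (fm o) (fp o)).
Proof.
move=> mfm mfp; apply: measurable_to_W => t z; rewrite /= /glue_fun.
have [_|_] /= := leP 0 t; rewrite -[X in measurable X]setTI.
  exact: (mfp measurableT _ (measurable_Wplus_coord (nng_abs t) z)).
exact: (mfm measurableT _ (measurable_Wplus_coord (nng_abs t) z)).
Qed.

Lemma measurable_Fwd : measurable_fun setT (@Fwd R).
Proof.
by apply: measurable_to_Wplus => t z; exact: (measurable_W_coord t%:num z).
Qed.

Lemma measurable_Bwd : measurable_fun setT (@Bwd R).
Proof.
apply: measurable_to_Wplus => t z.
have [t0|t0] := eqVneq t%:num 0; last first.
  rewrite (_ : [set o | _] = [set w : W R | sval w (- t%:num) = z]).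
    exact: measurable_W_coord.
  by rewrite /= /backward (negbTE t0).
(* The value at 0 of the reversed trajectory is a left limit; in a discrete space it is the eventual
   value along this sequence increasing to 0. *)
pose u n : R := - n.+1%:R^-1.
have u0 n : u n < 0 by rewrite oppr_lt0.
rewrite (_ : [set o | _] =
    \bigcup_n \bigcap_(m in [set m | (n <= m)%N]) [set w : W R | sval w (u m) = z]).
  apply: bigcupT_measurable => n; apply: bigcap_measurable => [|k _].
    by exists n => /=.
  exact: measurable_W_coord.
have ev (w : W R) : exists n, forall m, (n <= m)%N -> sval w (u m) = sval (Bwd w) t.
  have [e e0 he] := Wplus_rcont (Bwd w) t.
  have [n _ hn] := near_infty_natSinv_lt (PosNum e0).
  exists n => m nm; rewrite BwdE//; apply: he => /=.
  by rewrite t0 normr_ge0 add0r ltr0_norm// opprK; exact: hn.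
apply/seteqP; split => [w <-|w [n _ hn]].
  by have [n hn] := ev w; exists n.
have [n' hn'] := ev w; rewrite /mkset -(hn' (maxn n n')) ?leq_maxr//.
by apply: hn; rewrite /= leq_maxl.
Qed.

Lemma measurable_inside A (t : R) : measurable [set w : W R | inside A (sval w t)].
Proof.
apply: (@measurable_fibers _ _ _ (fun w : W R => sval w t) (inside A)).
exact: measurable_W_coord.
Qed.

Lemma measurable_W_enter A : measurable (@W_enter R A).
Proof.
rewrite (_ : W_enter A =
    \bigcup_(q : rat) [set w : W R | inside A (sval w (ratr q))]).
  apply: bigcup_measurable_count => q _.
  exact: measurable_inside.
apply/seteqP; split => [w [t Awt]|w [q _ Awq]]; last by exists (ratr q).
by have [q [wq _]] := W_rational w t; exists q => //=; rewrite wq.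
Qed.

Lemma measurable_W_enter_at0 A : measurable (@W_enter_at0 R A).
Proof.
rewrite (_ : W_enter_at0 A = [set w : W R | inside A (sval w 0)] `&`
    ~` \bigcup_(q in [set q : rat | (ratr q : R) < 0])
      [set w : W R | inside A (sval w (ratr q))]).
  apply: measurableI; first exact: measurable_inside.
  apply/measurableC/bigcup_measurable_count => q _.
  exact: measurable_inside.
apply/seteqP; split => w [Aw0 Aw]; split => //.
  by move=> [q q0 /=]; exact: Aw.
move=> t t0 Awt; apply: Aw; have [q [wq /(_ t0) q0]] := W_rational w t.
by exists q => //=; rewrite wq.
Qed.

Lemma measurable_pistar : measurable_fun setT (@pistar R).
Proof. by move=> _ B mB; rewrite setTI. Qed.

Lemma pistar_preimage_enter A : @pistar R @^-1` Wstar_enter A = W_enter A.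
Proof. by apply/seteqP; split=> w /Wstar_enterE. Qed.

Lemma measurable_Wstar_enter A : measurable (@Wstar_enter R A).
Proof.
change (measurable (@pistar R @^-1` Wstar_enter A)).
by rewrite pistar_preimage_enter; exact: measurable_W_enter.
Qed.

Definition W_rectangle (Em Ep : set (Wplus R)) : set (W R) :=
  @Bwd R @^-1` Em `&` @Fwd R @^-1` Ep.

Lemma measurable_W_rectangle Em Ep : measurable Em -> measurable Ep ->
  measurable (W_rectangle Em Ep).
Proof.
move=> mEm mEp; apply: measurableI; rewrite -[X in measurable X]setTI.
  exact: measurable_Bwd.
exact: measurable_Fwd.
Qed.

(** Rectangles are stable under intersection, and they include the coordinate events: a coordinate
    is read on the forward or the backward part according to the sign of its time. *)
Lemma W_rectangle_unique (m1 m2 : {measure set (W R) -> \bar R}) :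
  (m1 setT < +oo)%E ->
  (forall Em Ep, measurable Em -> measurable Ep ->
    m1 (W_rectangle Em Ep) = m2 (W_rectangle Em Ep)) ->
  forall B, measurable B -> m1 B = m2 B.
Proof.
move=> m1oo m12 B mB.
pose G := [set X | exists Em Ep, [/\ measurable Em, measurable Ep &
                                     X = W_rectangle Em Ep]].
have RT : W_rectangle setT setT = setT by rewrite /W_rectangle !preimage_setT setTI.
apply: (@measure_unique _ _ _ G (fun=> setT)) => //.
- apply/seteqP; split=> X; last first.
    apply: smallest_sub => //; first exact: sigma_algebra_measurable.
    by move=> _ [Em [Ep [mEm mEp ->]]]; exact: measurable_W_rectangle.
  apply: smallest_sub; first exact: smallest_sigma_algebra.
  move=> _ [t [z ->]]; apply: sub_sigma_algebra.
  have [t0|t0] := leP 0 t.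
    exists setT, [set f | sval f (nng_abs t) = z]; split => //.
      exact: measurable_Wplus_coord.
    rewrite /W_rectangle preimage_setT setTI; apply/seteqP.
    by split=> w /=; rewrite FwdE.
  exists [set f | sval f (nng_abs t) = z], setT; split => //.
    exact: measurable_Wplus_coord.
  rewrite /W_rectangle preimage_setT setIT; apply/seteqP.
  by split=> w /=; rewrite BwdE.
- move=> _ _ [Em [Ep [mEm mEp ->]]] [Em' [Ep' [mEm' mEp' ->]]].
  exists (Em `&` Em'), (Ep `&` Ep'); split; [exact: measurableI..|].
  by rewrite /W_rectangle !preimage_setI setIACA.
- by move=> _; exists setT, setT; split => //; rewrite RT.
- by rewrite bigcup_const.
- by move=> _ [Em [Ep [mEm mEp ->]]]; exact: m12.
Qed.

End TrajectoryMeasurability.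

(** * The forward and backward masses as probabilities of path events *)

Section HalfWalks.
Context (R : realType) (d : measure_display) (Omega : measurableType d).
Context (P : probability Omega R).
Context (step : nat -> Omega -> Z2) (hold : nat -> Omega -> R).
Context (model : srw_model P step hold).
Context (K' : set Z2).

Local Notation pos x o k := (x + \sum_(j < k) step j o).

Lemma hold_gt0 k o : 0 < hold k o.
Proof. by case: model. Qed.

Lemma measurable_hold k : measurable_fun setT (hold k).
Proof. by case: model. Qed.

Lemma measurable_pos x k z : measurable [set o | pos x o k = z].
Proof.
elim: k z => [|k IH] z.
  under eq_set do rewrite big_ord0 addr0.
  exact: measurable_prop.
under eq_set do rewrite big_ord_recr addrA.
apply: (@measurable_fibers _ _ _ (fun o => (pos x o k, step k o))
  [set u : Z2 * Z2 | u.1 + u.2 = z]) => -[u v].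
rewrite (_ : mkset _ = [set o | pos x o k = u] `&` [set o | step k o = v]).
  by apply: measurableI; [exact: IH|case: model].
by apply/seteqP; split=> o /= [-> ->].
Qed.

Lemma measurable_pos_set x k (Y : set Z2) : measurable [set o | Y (pos x o k)].
Proof. by apply: measurable_fibers => z; exact: measurable_pos. Qed.

(* The walk up to its exit time from K', observed from its m-th jump on: m = 0
   for the forward and m = 1 for the backward part of the trajectory. *)
Definition half_event m (B : set Z2) x (E : set (Wplus R)) : set Omega :=
  [set o | exists2 N, first_exit step K' x o N &
    [/\ (m <= N)%N, forall a, (m <= a <= N)%N -> ~ B (pos x o a) &
        E (path_Wplus (N - m) (fun k => pos x o (m + k)%N)
             (fun k => hold (m + k)%N o))]].

Lemma half_eventE m B x E : K' x -> (m <= 1)%N ->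
  [set o | (sval @` E) (fun t : {nonneg R} =>
             killed K' (walk step hold x o) (jump_time hold m o + t%:num)) /\
           (exit_time K' (walk step hold x o) <
            entrance_from (jump_time hold m o) B (walk step hold x o))%E] =
  half_event m B x E.
Proof.
(* A walk started in [K'] needs at least one step to leave it. *)
move=> Kx m1; have mN o N : first_exit step K' x o N -> (m <= N)%N.
  move=> [_]; case: N => [|N] KN; last exact: leq_trans m1 _.
  by move: KN; rewrite big_ord0 addr0.
apply/seteqP; split=> o /=.
  move=> [EX /(exit_before_entranceP step hold_gt0)[N eN NB]]; exists N => //.
  split=> //; first exact: mN eN.
  apply/in_sval_image; last exact: EX.
  by rewrite (killed_path hold_gt0 eN)//; exact: mN eN.
move=> [N eN [mlN NB EN]]; split; last first.
  by apply/(exit_before_entranceP step hold_gt0); exists N.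
rewrite (killed_path hold_gt0 eN)//.
exact/in_sval_image.
Qed.

Lemma forward_massE K x E : K' x ->
  forward_mass P step hold K K' x E = P (half_event 0 K x E).
Proof.
move=> Kx; rewrite -half_eventE// /forward_mass; congr (P _).
suff e o : (fun t : {nonneg R} =>
      killed K' (walk step hold x o) (jump_time hold 0 o + t%:num)) =
    (fun t : {nonneg R} => killed K' (walk step hold x o) t%:num).
  by apply: eq_set => o; rewrite e [jump_time hold 0 o]big_ord0.
by apply/funext => t; rewrite [jump_time hold 0 o]big_ord0 add0r.
Qed.

Lemma backward_massE A x E : K' x ->
  backward_mass P step hold A K' x E = P (half_event 1 A x E).
Proof. by move=> Kx; rewrite -half_eventE. Qed.

Lemma measurable_half_event m B x E : measurable E ->
  measurable (half_event m B x E).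
Proof.
move=> mE; rewrite (_ : half_event m B x E = \bigcup_(N in [set N | (m <= N)%N])
  ((\bigcap_(a in [set a | (a < N)%N]) [set o | K' (pos x o a)]) `&`
   [set o | (~` K') (pos x o N)] `&`
   (\bigcap_(a in [set a | (m <= a <= N)%N]) [set o | (~` B) (pos x o a)]) `&`
   [set o | E (path_Wplus (N - m) (fun k => pos x o (m + k)%N)
                (fun k => hold (m + k)%N o))])).
  apply: bigcup_measurable => N _.
  apply: measurableI; last first.
    have mf : measurable_fun setT (fun o => path_Wplus (N - m)
        (fun k => pos x o (m + k)%N) (fun k => hold (m + k)%N o)).
      apply: (@measurable_path_Wplus _ _ _ _ (fun k o => pos x o (m + k)%N)
        (fun k o => hold (m + k)%N o)) => k.
        by move=> u; exact: measurable_pos.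
      exact: measurable_hold.
    by have := mf measurableT _ mE; rewrite setTI.
  apply: measurableI; last first.
    by apply: bigcap_measurableType => a _; exact: measurable_pos_set.
  apply: measurableI; last exact: measurable_pos_set.
  by apply: bigcap_measurableType => a _; exact: measurable_pos_set.
apply/seteqP; split=> o.
  by move=> [N [N1 N2] [mN NB EN]]; exists N.
by move=> [N mN [[[N1 N2] NB] EN]]; exists N.
Qed.

Definition step_weight (u v : Z2) : \bar R :=
  (if unit_step (v - u) then 4^-1 else 0)%:E.

Lemma step_weightC u v : step_weight u v = step_weight v u.
Proof. by rewrite /step_weight /unit_step -opprB/= !abszN. Qed.

(** Prescribing the positions amounts to prescribing their increments, which are the independent
    steps of the model. *)
Lemma path_law n (y : nat -> Z2) (C : nat -> set R) :
  (forall k, measurable (C k)) ->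
  P [set o | (forall k, (k <= n)%N -> pos (y 0%N) o k = y k) /\
             (forall k, (k < n)%N -> C k (hold k o))] =
  ((\prod_(0 <= k < n) step_weight (y k) (y k.+1)) *
   (\prod_(0 <= k < n) exponential_prob 1 (C k)))%E.
Proof.
move=> mC; have [_ _ _ law] := model.
rewrite -big_split/= big_mkord.
rewrite -(law n (fun k : 'I_n => y k.+1 - y k) (fun k : 'I_n => C k))//.
congr (P _); apply/seteqP; split=> o /=.
  move=> [yo Co] k; split; last exact: Co.
  have := yo k.+1 (ltn_ord k); have := yo k (ltnW (ltn_ord k)).
  by rewrite big_ord_recr/= addrA => -> <-; rewrite addrAC subrr add0r.
move=> h; split=> [k|k kn]; last exact: (h (Ordinal kn)).2.
elim: k => [|k IH] kn; first by rewrite big_ord0 addr0.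
rewrite big_ord_recr/= addrA IH ?(ltnW kn)// (h (Ordinal kn)).1/=.
by rewrite addrCA subrr addr0.
Qed.

End HalfWalks.

(** * The space of sequences of holding times *)

Section HoldingTimes.
Context (R : realType).

(** Infinite sequences serve words of every length at once. Boxes constrain all coordinates together
    so as to be stable under intersection. *)
Definition hold_boxes : set (set (nat -> R)) :=
  [set C | exists2 B : nat -> set R, (forall k, measurable (B k)) &
    C = [set h | forall k, B k (h k)]].

Definition hold_space := g_sigma_algebraType hold_boxes.
HB.instance Definition _ := Measurable.on hold_space.

Lemma measurable_hold_coord k : measurable_fun setT (fun h : hold_space => h k).
Proof.
move=> _ B mB; rewrite setTI; apply: sub_sigma_algebra.
exists (fun i => if i == k then B else setT); first by move=> i; case: ifP.
apply/seteqP; split=> h /= hB; last by have := hB k; rewrite eqxx.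
by move=> i; case: ifPn => // /eqP ->.
Qed.

Lemma measurable_to_hold_space d (T : measurableType d) (g : T -> hold_space) :
  (forall k, measurable_fun setT (fun o => g o k)) -> measurable_fun setT g.
Proof.
move=> mg; apply: (@measurability _ _ T hold_space setT g hold_boxes) => //.
move=> _ [_ [B mB ->] <-]; rewrite setTI.
rewrite (_ : _ @^-1` _ = \bigcap_k [set o | B k (g o k)]).
  apply: bigcap_measurableType => k _.
  by have := mg k measurableT _ (mB k); rewrite setTI.
by apply/seteqP; split=> o /= h k; have := h k => //; exact.
Qed.

Lemma hold_space_unique (m1 m2 : {measure set hold_space -> \bar R}) :
  (m1 setT < +oo)%E ->
  (forall B : nat -> set R, (forall k, measurable (B k)) ->
    m1 [set h | forall k, B k (h k)] = m2 [set h | forall k, B k (h k)]) ->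
  forall Y, measurable Y -> m1 Y = m2 Y.
Proof.
move=> m1oo m12 Y mY.
apply: (@measure_unique _ R hold_space hold_boxes (fun=> setT) _ _ _ _ m1 m2) => //.
- move=> _ _ [B mB ->] [C mC ->]; exists (fun k => B k `&` C k).
    by move=> k; exact: measurableI.
  apply/seteqP; split=> h /= => [[hB hC] k|hBC]; first by split.
  by split=> k; case: (hBC k).
- by move=> _; exists (fun=> setT) => //; apply/seteqP; split.
- by rewrite bigcup_const.
- by move=> _ [B mB ->]; exact: m12.
Qed.

End HoldingTimes.

(** * Image measures and measures carried by a set *)

Section ImageMeasure.
Context d1 d2 (T1 : measurableType d1) (T2 : measurableType d2) (R : realType).
Context (m : {measure set T1 -> \bar R}) (f : T1 -> T2).
Context (mf : measurable_fun setT f).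

Definition image_measure : {measure set T2 -> \bar R}.
Proof.
refine (pushforward m f : {measure set T2 -> \bar R}); exact: mf.
Defined.

Lemma image_measureE B : image_measure B = m (f @^-1` B).
Proof. by []. Qed.

End ImageMeasure.

Lemma measure_fullI d' (T : measurableType d') (R : realType)
    (mu : {measure set T -> \bar R}) (D B : set T) :
  measurable D -> mu (~` D) = 0%E -> measurable B -> mu B = mu (B `&` D).
Proof.
move=> mD D0 mB; rewrite (measureDI mu mB mD).
rewrite (@subset_measure0 _ _ _ mu (B `\` D) (~` D)) ?add0e//.
- exact: measurableD.
- exact: measurableC.
Qed.

(** * Construction of Q_A as a sum over words, and its consistency in A *)

Section Words.
Context (R : realType) (d : measure_display) (Omega : measurableType d).
Context (P : probability Omega R).
Context (step : nat -> Omega -> Z2) (hold : nat -> Omega -> R).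
Context (model : srw_model P step hold).
Context (K K' : set Z2).
Implicit Types (A : set Z2) (s : seq Z2) (o : Omega * Omega).

Local Notation pos x o k := (x + \sum_(j < k) step j o).

(* A word is the whole path, including the points outside K' through which it
   enters and leaves K'. *)
Definition entry A s := find (fun z => `[< A z >]) s.

Definition len s := (size s).-1.

Definition valid_word A s :=
  [/\ has (fun z => `[< A z >]) s, ~ K' s`_0, ~ K' s`_(len s) &
      forall k, (0 < k < len s)%N -> (K' `\` K) s`_k].

Lemma entry_in A s : valid_word A s -> A s`_(entry A s).
Proof. by move=> [/(nth_find 0)/asboolP]. Qed.

Lemma entry_before A s k : (k < entry A s)%N -> ~ A s`_k.
Proof. by move=> /(before_find 0)/negbT/asboolPn. Qed.

(** The first and last letters lie outside [K'], hence outside [A], so the cut is strictly inside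
    the word. *)
Lemma entry_bounds A s : A `<=` K' -> valid_word A s ->
  (0 < entry A s < len s)%N.
Proof.
move=> AK vs; have As := entry_in vs; have [hs n0 nl _] := vs.
have : (entry A s < size s)%N by rewrite -has_find.
case: (ltngtP 0 (entry A s)) => [e0|//|e0]; last first.
  by case: n0; apply: AK; rewrite e0.
rewrite /len in nl *; case: (size s) nl As => // l /= nl As; rewrite ltnS leq_eqVlt.
move=> /orP[/eqP e1|//]; case: nl; apply: AK.
by rewrite -e1.
Qed.

Lemma valid_wordS A B s : A `<=` B -> valid_word A s -> valid_word B s.
Proof.
move=> AB [hs n0 nl vs]; split=> //.
by apply: sub_has hs => z /asboolP/AB/asboolP.
Qed.

(** Validity is part of the event, so that an invalid word has an empty event and the sum can run
    over all words. *)
Definition word_event A s : set (Omega * Omega) :=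
  [set o | [/\ valid_word A s,
    forall k, (k <= entry A s)%N ->
      pos s`_(entry A s) o.1 k = s`_(entry A s - k) &
    forall k, (k <= len s - entry A s)%N ->
      pos s`_(entry A s) o.2 k = s`_(entry A s + k)]].

(** The backward part starts at the letter before the entry with the holding time of index 1, the
    one of index 0 being discarded. The extreme letters lie outside [K'] and are replaced by the
    cemetery. *)
Definition two_sided A s o : W R :=
  glue (path_Wplus (entry A s - 1) (fun k => s`_(entry A s - k.+1))
          (fun k => hold k.+1 o.1))
       (path_Wplus (len s - entry A s) (fun k => s`_(entry A s + k))
          (hold^~ o.2)).

(* The holding times along the word in chronological order, padded with 1. *)
Definition word_holds A s o (k : nat) : R :=
  if (k < entry A s - 1)%N then hold (entry A s - 1 - k) o.1
  else if (k < len s - 1)%N then hold (k - (entry A s - 1)) o.2 else 1.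

(* The trajectory started at the time of its entrance in K'. *)
Definition one_sided s (h : nat -> R) : W R :=
  glue (path_Wplus 0 (fun=> 0) (fun=> 1))
       (path_Wplus (len s - 1) (fun k => s`_k.+1) h).

Lemma word_holds_gt0 A s o k : 0 < word_holds A s o k.
Proof.
rewrite /word_holds; case: ifP => _; first exact: (hold_gt0 model).
by case: ifP => // _; exact: (hold_gt0 model).
Qed.

Lemma one_sided_shift A s o : A `<=` K' -> valid_word A s ->
  pistar (two_sided A s o) = pistar (one_sided s (word_holds A s o)).
Proof.
move=> AK vs; have /andP[j0 jl] := entry_bounds AK vs.
set h := word_holds A s o; set j := entry A s in j0 jl *.
have h0 : forall k, 0 < h k by move=> k; exact: word_holds_gt0.
have hb0 : forall k, 0 < hold k.+1 o.1 by move=> k; exact: (hold_gt0 model).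
have hf0 : forall k, 0 < hold k o.2 by move=> k; exact: (hold_gt0 model).
have lE : (len s - 1)%N = ((j - 1) + (len s - j))%N by lia.
(* The shift is the time spent in [K'] before the entrance in [A], at the letters of index 1 to
   [j - 1]. *)
apply/esym/pistar_eqP; exists (psum h (j - 1)).
have Phi0 u : 0 <= u -> sval (one_sided s h) u =
    path_traj (len s - 1) (fun k => s`_k.+1) h u.
  by move=> u0; rewrite /= /glue_fun u0 /= ger0_norm// hposE.
have fwd u : 0 <= u ->
    sval (one_sided s h) (psum h (j - 1) + u) = sval (two_sided A s o) u.
  move=> u0; rewrite Phi0 ?addr_ge0 ?psum_ge0// lE path_traj_drop//.
  rewrite /= /glue_fun u0 /= ger0_norm// hposE//.
  apply: eq_path_traj => k kn.
    by congr nth; lia.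
  rewrite /h /word_holds -/j ltnNge leq_addr/=.
  by rewrite lE ltn_add2l kn addKn.
(* Here [two_sided] is left-continuous while [one_sided], at nonnegative times, is right-continuous,
   so the jump times are excluded. *)
have bwd u : u < 0 ->
    (forall k, (k < j - 1)%N -> psum h (j - 1) + u <> psum h k) ->
    sval (one_sided s h) (psum h (j - 1) + u) = sval (two_sided A s o) u.
  move=> u0 une; have -> : sval (two_sided A s o) u =
      path_traj (j - 1) (fun k => s`_(j - k.+1)) (fun k => hold k.+1 o.1) (- u).
    by rewrite /= /glue_fun leNgt u0/= ltr0_norm// hposE.
  have revE : psum h (j - 1) = psum (fun k => hold k.+1 o.1) (j - 1).
    rewrite /psum (reindex_inj rev_ord_inj); apply: eq_bigr => -[k kj] _ /=.
    rewrite /h /word_holds -/j; have -> : (j - 1 - k.+1 < j - 1)%N by lia.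
    by congr (hold _ _); lia.
  (* Before the entrance in [K'] both trajectories are at the cemetery. *)
  have [c0|c0] := leP 0 (psum h (j - 1) + u); last first.
    rewrite path_traj_dead//; last by rewrite -revE; lra.
    by rewrite /= /glue_fun leNgt c0.
  rewrite Phi0// (_ : - u = psum h (j - 1) - (psum h (j - 1) + u)); last by lra.
  rewrite -(@path_traj_rev _ (j - 1) (fun k => s`_k.+1) _ h)//; last 3 first.
  - by move=> k kj; congr nth; lia.
  - move=> k kj; rewrite /h /word_holds -/j kj; congr (hold _ _); lia.
  - by rewrite c0/=; lra.
  have clt : psum h (j - 1) + u < psum h (j - 1) by lra.
  have [k kj kt] := psum_locate c0 clt.
  by rewrite !(path_traj_in _ h0 _ kt)// lE ltn_addr.
split=> t t0.
  near=> u; have u0 : 0 <= u.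
    by rewrite (le_trans t0)//; apply: ltW; near: u; exact: nbhs_right_gt.
  by rewrite fwd//; near: u; exact: W_near_right.
have ne (a : R) : \forall u \near t^'-, u <> a.
  have [ta|at_] := leP t a.
    by apply: filterS (nbhs_left_lt t) => u ut ua; move: ut; rewrite ua ltNge ta.
  by apply: filterS (nbhs_left_gt at_) => u + ua; rewrite ua ltxx.
(* Finitely many excluded times are avoided by a small left neighbourhood of [t]. *)
have nes n : \forall u \near t^'-, forall k, (k < n)%N ->
    psum h (j - 1) + u <> psum h k.
  elim: n => [|n IH]; first exact: nearW.
  near=> u => k; rewrite ltnS leq_eqVlt => /orP[/eqP ->|kn].
    suff : u <> psum h n - psum h (j - 1) by move=> + E; apply; lra.
    by near: u; exact: ne.
  by move: k kn; near: u; exact: IH.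
near=> u; have u0 : u < 0.
  by rewrite (lt_trans _ t0)//; near: u; exact: nbhs_left_lt.
rewrite bwd//; first by near: u; exact: W_near_left.
by near: u; exact: nes.
Unshelve. all: by end_near. Qed.

Lemma one_sided_enter A s h : A `<=` K' -> valid_word A s ->
  W_enter A (one_sided s h).
Proof.
move=> AK vs; have /andP[j0 jl] := entry_bounds AK vs.
have hp := hpos_gt0 h.
(* The initial letter has no holding time, whence the predecessor. *)
exists (psum (hpos h) (entry A s).-1), s`_(entry A s); first exact: entry_in.
rewrite /= /glue_fun psum_ge0//= ger0_norm ?psum_ge0//.
rewrite (@path_traj_in _ _ _ _ _ (entry A s).-1) ?prednK//; [by lia|].
by rewrite lexx -{2}(prednK j0) psumSr ltrDl hp.
Qed.

Lemma one_sided_enter_has A s h : W_enter A (one_sided s h) ->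
  has (fun z => `[< A z >]) s.
Proof.
move=> [t [z Az]]; rewrite /= /glue_fun; case: ifPn => // t0 /=.
have hp := hpos_gt0 h.
have [|lt] := leP (psum (hpos h) (len s - 1)) `|t|.
  by move=> /path_traj_dead ->.
have [k kn kt] := psum_locate (normr_ge0 t) lt.
rewrite (path_traj_in _ hp kn kt) => -[zE].
apply/hasP; exists z; last exact/asboolP.
by rewrite -zE mem_nth// -ltn_predRL (leq_trans kn) ?leq_subr.
Qed.

Local Notation PP := (P \x P)%E.

Lemma measurable_word_event A s : measurable (word_event A s).
Proof.
have [vs|nvs] := pselect (valid_word A s); last first.
  by rewrite (_ : word_event A s = set0)//; apply/seteqP; split=> // o [].
rewrite (_ : word_event A s =
  \bigcap_(k in [set k | (k <= entry A s)%N])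
    [set o : Omega | pos s`_(entry A s) o k = s`_(entry A s - k)] `*`
  \bigcap_(k in [set k | (k <= len s - entry A s)%N])
    [set o : Omega | pos s`_(entry A s) o k = s`_(entry A s + k)]).
  by apply: measurableX; apply: bigcap_measurableType => k _;
    exact: (measurable_pos model).
by apply/seteqP; split=> o [] => [_ o1 o2|o1 o2]; split.
Qed.

Lemma measurable_two_sided A s : measurable_fun setT (two_sided A s).
Proof.
apply: measurable_glue.
  apply: (@measurable_path_Wplus _ _ _ _ (fun k _ => s`_(entry A s - k.+1))
    (fun k o => hold k.+1 o.1)) => k.
    by move=> u; exact: measurable_prop.
  exact: measurableT_comp (measurable_hold model _) measurable_fst.
apply: (@measurable_path_Wplus _ _ _ _ (fun k _ => s`_(entry A s + k))
  (fun k o => hold k o.2)) => k.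
  by move=> u; exact: measurable_prop.
exact: measurableT_comp (measurable_hold model _) measurable_snd.
Qed.

Lemma measurable_word_holds A s :
  measurable_fun setT (word_holds A s : _ -> hold_space R).
Proof.
apply: measurable_to_hold_space => k; rewrite /word_holds.
have [_|_] := ltnP k (entry A s - 1); last have [_|_] // := ltnP k (len s - 1).
  exact: measurableT_comp (measurable_hold model _) measurable_fst.
exact: measurableT_comp (measurable_hold model _) measurable_snd.
Qed.

Lemma measurable_one_sided s :
  measurable_fun setT (one_sided s : hold_space R -> W R).
Proof.
apply: measurable_glue => //.
apply: (@measurable_path_Wplus _ _ _ _ (fun k _ => s`_k.+1)
  (fun k (h : hold_space R) => h k)) => k.
  by move=> u; exact: measurable_prop.
exact: measurable_hold_coord.
Qed.

(** The right-hand side does not involve [A]. The last hypothesis lets the padding satisfy the box,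
    so that only [len s - 1] holding times are constrained. *)
Lemma word_event_box A s (B : nat -> set R) : A `<=` K' -> valid_word A s ->
  (forall k, measurable (B k)) -> (forall k, (len s - 1 <= k)%N -> B k 1) ->
  PP (word_event A s `&` [set o | forall k, B k (word_holds A s o k)]) =
  ((\prod_(0 <= k < len s) step_weight R s`_k s`_k.+1) *
   (\prod_(0 <= k < len s - 1) exponential_prob 1 (B k)))%E.
Proof.
move=> AK vs mB B1; have /andP[j0 jl] := entry_bounds AK vs.
set j := entry A s in j0 jl *.
(* The discarded holding time of the backward walk is unconstrained; its later ones fill the box in
   reverse order. *)
pose C k := if k == 0%N then setT else B (j - 1 - k)%N.
pose D k := B (j - 1 + k)%N.
pose yb k := s`_(j - k); pose yf k := s`_(j + k).
have mC k : measurable (C k) by rewrite /C; case: ifP.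
have mD k : measurable (D k) by exact: mB.
have mpath n (y : nat -> Z2) (E : nat -> set R) :
    (forall k, measurable (E k)) ->
    measurable [set o : Omega |
      (forall k, (k <= n)%N -> pos (y 0%N) o k = y k) /\
      (forall k, (k < n)%N -> E k (hold k o))].
  move=> mE; rewrite (_ : mkset _ =
    \bigcap_(k in [set k | (k <= n)%N]) [set o : Omega | pos (y 0%N) o k = y k] `&`
    \bigcap_(k in [set k | (k < n)%N]) hold k @^-1` E k).
    apply: measurableI; apply: bigcap_measurableType => k _.
      exact: (measurable_pos model).
    by rewrite -[X in measurable X]setTI; exact: (measurable_hold model).
  by apply/seteqP; split=> o.
rewrite (_ : _ `&` _ =
  [set o : Omega | (forall k, (k <= j)%N -> pos (yb 0%N) o k = yb k) /\
    (forall k, (k < j)%N -> C k (hold k o))] `*`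
  [set o : Omega | (forall k, (k <= len s - j)%N -> pos (yf 0%N) o k = yf k) /\
    (forall k, (k < len s - j)%N -> D k (hold k o))]); last first.
  rewrite /yb /yf subn0 addn0; apply/seteqP; split=> o; case: o => o1 o2 /=.
    move=> [[_ e1 e2] hB]; split; split=> // k kn.
      rewrite /C; case: eqP => // /eqP k0.
      have := hB (j - 1 - k)%N; rewrite /word_holds -/j.
      have -> : (j - 1 - k < j - 1)%N by lia.
      by have -> : (j - 1 - (j - 1 - k) = k)%N by lia.
    have := hB (j - 1 + k)%N; rewrite /word_holds -/j ltnNge leq_addr/= addKn.
    by have -> : (j - 1 + k < len s - 1)%N by lia.
  move=> [[e1 hC] [e2 hD]]; split; first by split.
  move=> k; rewrite /word_holds -/j; case: ltnP => kj.
    have := hC (j - 1 - k)%N; rewrite /C.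
    have -> : (j - 1 - k == 0)%N = false by lia.
    have -> : (j - 1 - (j - 1 - k) = k)%N by lia.
    by apply; lia.
  case: ltnP => kl; last exact: B1.
  have := hD (k - (j - 1))%N; rewrite /D subnKC//; apply; lia.
rewrite product_measure1E; [|exact: mpath..].
apply: etrans (congr2 mule (path_law model j yb mC)
  (path_law model (len s - j) yf mD)) _.
rewrite muleACA; congr (_ * _)%E.
  (* The backward walk crosses the first [j] edges in the reverse direction, which the symmetry of
     [step_weight] undoes. *)
  rewrite (big_cat_nat (n := j) _ (ltnW jl))//=; congr (_ * _)%E.
    rewrite [RHS]big_nat_rev/= add0n; apply: eq_big_nat => k /andP[_ kj].
    by rewrite /yb step_weightC subnSK.
  rewrite -{2}[j]add0n big_addn; apply: eq_bigr => k _.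
  by rewrite /yf addnS addnC.
rewrite (big_cat_nat (n := (j - 1)%N) _ (leq_sub2r 1 (ltnW jl)))//=; congr (_ * _)%E.
  (* The unconstrained factor has mass 1 and drops out, leaving [j - 1] factors. *)
  rewrite -{1}(prednK j0) big_nat_recl//= {1}/C/=.
  rewrite [exponential_prob 1 setT]integral_exponential_pdf// mul1e subn1.
  rewrite big_nat_rev/= add0n; apply: eq_big_nat => k /andP[_ kj].
  by rewrite /C/= subn1; congr (exponential_prob 1 (B _)); lia.
rewrite -[(j - 1)%N]add0n big_addn.
have -> : (len s - 1 - (j - 1) = len s - j)%N by lia.
by apply: eq_bigr => k _; rewrite /D addnC.
Qed.

(* The law of the path and of its holding times does not depend on the set A at
   whose entrance time the path is cut in two. *)
Lemma word_event_law A A' s Y : A `<=` K' -> A' `<=` K' ->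
  valid_word A s -> valid_word A' s -> measurable (Y : set (hold_space R)) ->
  PP (word_event A s `&` word_holds A s @^-1` Y) =
  PP (word_event A' s `&` word_holds A' s @^-1` Y).
Proof.
move=> AK A'K vs vs' mY.
pose m A0 := image_measure (mrestr PP (measurable_word_event A0 s))
  (measurable_word_holds A0 s).
have mE A0 X : m A0 X = PP (word_event A0 s `&` word_holds A0 s @^-1` X).
  by rewrite /m image_measureE /mrestr setIC.
rewrite -!mE; apply: hold_space_unique => //.
  rewrite mE preimage_setT setIT (le_lt_trans (probability_le1 _ _))//.
  - exact: measurable_word_event.
  - by rewrite ltry.
move=> B mB; rewrite !mE.
(* A box excluding the padding value 1 at some index beyond the word gives an empty event for either
   cut. *)
have [B1|] := pselect (forall k, (len s - 1 <= k)%N -> B k 1).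
  by rewrite !word_event_box.
move=> /existsNP[k /not_implyP[kl Bk]].
have box0 A0 : A0 `<=` K' -> valid_word A0 s ->
    word_event A0 s `&` word_holds A0 s @^-1` [set h | forall k, B k (h k)] = set0.
  move=> A0K v0; apply/seteqP; split=> // o [_ /(_ k)].
  rewrite /word_holds.
  have /andP[j0 jl] := entry_bounds A0K v0.
  rewrite ifF; last by lia.
  by rewrite ifF//; lia.
by rewrite !box0.
Qed.

(** Indices encoding no word give the empty word, which is invalid and contributes nothing. *)
Definition word n : seq Z2 := odflt [::] (pickle_inv n).

Definition QA_word A s : {measure set (W R) -> \bar R} :=
  image_measure (mrestr PP (measurable_word_event A s))
    (measurable_two_sided A s).

Definition QA A : {measure set (W R) -> \bar R} :=
  mseries (QA_word A \o word) 0.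

Lemma QA_wordE A s X :
  QA_word A s X = PP (two_sided A s @^-1` X `&` word_event A s).
Proof. by []. Qed.

Lemma two_sided0 A s o : A `<=` K' -> valid_word A s ->
  sval (two_sided A s o) 0 = Some s`_(entry A s).
Proof.
move=> AK /(entry_bounds AK)/andP[_ jl].
rewrite /= /glue_fun lexx/= normr0 -(subnSK jl)/= addn0.
by rewrite hpos_gt0.
Qed.

Lemma word_event_Bwd A s o : A `<=` K' -> word_event A s o ->
  Bwd (two_sided A s o) = path_Wplus (entry A s - 1)
    (fun k => pos s`_(entry A s) o.1 (1 + k)%N) (fun k => hold (1 + k)%N o.1).
Proof.
move=> AK [vs e1 _]; rewrite Bwd_glue; apply: eq_path_Wplus => // k kj.
by rewrite e1//; lia.
Qed.

Lemma word_event_Fwd A s o : A `<=` K' -> word_event A s o ->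
  Fwd (two_sided A s o) = path_Wplus (len s - entry A s - 0)
    (fun k => pos s`_(entry A s) o.2 (0 + k)%N) (fun k => hold (0 + k)%N o.2).
Proof.
move=> AK [vs _ e2]; rewrite Fwd_glue subn0; apply: eq_path_Wplus => // k kj.
by rewrite e2//; exact: ltnW.
Qed.

Lemma word_event_exit A s o : A `<=` K' -> word_event A s o ->
  first_exit step K' s`_(entry A s) o.1 (entry A s) /\
  first_exit step K' s`_(entry A s) o.2 (len s - entry A s).
Proof.
move=> AK [vs e1 e2]; have /andP[j0 jl] := entry_bounds AK vs.
have [_ n0 nl vk] := vs; split; split.
- move=> a aj; rewrite e1 ?(ltnW aj)//.
  by have [] : (K' `\` K) s`_(entry A s - a); first by apply: vk; lia.
- by rewrite e1// subnn.
- move=> a aj; rewrite e2 ?(ltnW aj)//.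
  by have [] : (K' `\` K) s`_(entry A s + a); first by apply: vk; lia.
- by rewrite e2// subnKC// ltnW.
Qed.

(** From a common entry point, the exit indices of the two walks give the entry index and the
    length, and their positions then give the letters. This makes the sum over words a disjoint
    union. *)
Lemma word_event_uniq A s s' o : A `<=` K' ->
  s`_(entry A s) = s'`_(entry A s') -> word_event A s o -> word_event A s' o ->
  s = s'.
Proof.
move=> AK xx' ws ws'.
have [b f] := word_event_exit AK ws; have [b' f'] := word_event_exit AK ws'.
rewrite xx' in b f.
have jj' := first_exit_uniq b b'.
have ll' := first_exit_uniq f f'.
have [vs e1 e2] := ws; have [vs' e1' e2'] := ws'.
have /andP[j0 jl] := entry_bounds AK vs.
have /andP[j0' jl'] := entry_bounds AK vs'.
rewrite -jj' in e1' e2' ll' jl'.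
have lenE : len s = len s' by lia.
have sE : size s = size s' by move: lenE jl jl'; rewrite /len; lia.
apply: (@eq_from_nth _ 0) => // k ks.
have kl : (k <= len s)%N by rewrite /len -ltnS prednK// (leq_trans _ ks).
rewrite -jj' in xx'.
have [kj|jk] := leqP k (entry A s).
  have := e1 (entry A s - k)%N; have := e1' (entry A s - k)%N.
  by rewrite leq_subr subKn// xx' => <-// <-.
have kl' : (k - entry A s <= len s - entry A s)%N by rewrite leq_sub2r.
have := e2 _ kl'; rewrite lenE in kl'; have := e2' _ kl'.
by rewrite subnKC ?(ltnW jk)// xx' => <- <-.
Qed.

Lemma QA_is_QA A : K `<=` A -> A `<=` K' -> is_QA P step hold K K' A (QA A).
Proof.
move=> KA AK; split.
  rewrite /QA /= /mseries eseries0// => n _ _ /=; rewrite QA_wordE.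
  rewrite (_ : _ `&` _ = set0) ?measure0//; apply/seteqP; split=> // o [+ ws]; apply.
  have [vs e1 e2] := ws; have /andP[j0 jl] := entry_bounds AK vs.
  split.
    rewrite two_sided0//; exists (word n)`_(entry A (word n)) => //.
    exact: entry_in vs.
  (* At negative times only letters preceding the entry are visited. *)
  move=> t t0 [z Az]; rewrite BwdE// Bwd_glue/=.
  have hp := hpos_gt0 (fun k => hold k.+1 o.1).
  have [/path_traj_dead ->//|lt] :=
    leP (psum (hpos (fun k => hold k.+1 o.1)) (entry A (word n) - 1)) `|t|.
  have [k kn kt] := psum_locate (normr_ge0 t) lt.
  rewrite (path_traj_in _ hp kn kt) => -[zE].
  by apply: (@entry_before A (word n) (entry A (word n) - k.+1)); [lia|rewrite zE].
move=> Em Ep x mEm mEp Ax; have Kx := AK _ Ax.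
rewrite (backward_massE model)// (forward_massE model)//.
rewrite -product_measure1E; [|exact: (measurable_half_event model)..].
set X := [set w | _].
have XE o s : word_event A s o -> X (two_sided A s o) <->
    [/\ Em (Bwd (two_sided A s o)), s`_(entry A s) = x &
        Ep (Fwd (two_sided A s o))].
  move=> ws; have [vs _ _] := ws.
  have w0 : sval (two_sided A s o) 0 = Some s`_(entry A s) by exact: two_sided0.
  split=> [[EM xE EP]|[EM xE EP]]; split.
  - by apply/in_sval_image; last exact: EM.
  - by move: xE; rewrite w0 => -[].
  - by apply/in_sval_image; last exact: EP.
  - by apply/in_sval_image; last exact: EM.
  - by rewrite w0 xE.
  - by apply/in_sval_image; last exact: EP.
have mX : measurable (X : set (W R)).
  rewrite (_ : X = W_rectangle Em Ep `&` [set w | sval w 0 = Some x]).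
    by apply: measurableI; [exact: measurable_W_rectangle|exact: measurable_W_coord].
  apply/seteqP; split=> w.
    move=> [EM xE EP]; split=> //; split; apply/in_sval_image; [|exact: EM| |exact: EP] => //.
  move=> [[EM EP] xE]; split=> //; apply/in_sval_image; [|exact: EM| |exact: EP] => //.
rewrite /QA /= /mseries.
under eq_eseriesr do rewrite /= QA_wordE.
(* The series is the mass of a disjoint union over words, to be identified with the product of the
   two half events. *)
rewrite -measure_semi_bigcup.
- congr (PP _); apply/seteqP; split=> o.
    move=> [n _ [Xo ws]]; move: (ws) (Xo) => [vs e1 e2] /(XE _ _ ws)[EM xE EP].
    have /andP[j0 jl] := entry_bounds AK vs.
    have [f1 f2] := word_event_exit AK ws; have [_ _ _ vk] := vs.
    rewrite xE in f1 f2 e1 e2.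
    split.
      exists (entry A (word n)) => //; split=> //.
      + move=> a /andP[a0 aj]; rewrite e1//; apply: entry_before; lia.
      + by move: EM; rewrite word_event_Bwd// xE.
    exists (len (word n) - entry A (word n))%N => //; split=> //.
    (* Interior letters avoid [K] by validity, and the last one lies outside [K'], which contains
       [K]. *)
    + move=> a /= al Ka.
      have [aj|] := ltnP a (len (word n) - entry A (word n)).
        have [] : (K' `\` K) (word n)`_(entry A (word n) + a) by apply: vk; lia.
        by move=> _; apply; rewrite -e2.
      move=> la; have aE : a = (len (word n) - entry A (word n))%N.
        by apply/eqP; rewrite eqn_leq al la.
      by case: f2 => _; apply; rewrite -aE; apply/AK/KA.
    + by move: EP; rewrite word_event_Fwd// xE.
  case: o => o1 o2 /= [[N1 [f1 g1] [n1 nA EM]] [N2 [f2 g2] [_ nK EP]]] /=.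
  have N20 : (0 < N2)%N.
    by rewrite lt0n; apply/eqP => N20; apply: g2; rewrite N20 big_ord0 addr0.
  (* Conversely, the word is the reversed backward path followed by the forward one, joined at [x]
     in position [N1]. *)
  pose y k := if (k <= N1)%N then pos x o1 (N1 - k)%N else pos x o2 (k - N1)%N.
  pose s := mkseq y (N1 + N2).+1.
  have sy k : (k <= N1 + N2)%N -> s`_k = y k by move=> kN; rewrite nth_mkseq.
  have lE : len s = (N1 + N2)%N by rewrite /len size_mkseq.
  have yN1 : y N1 = x by rewrite /y leqnn subnn big_ord0 addr0.
  have ysub k : (k <= N1)%N -> s`_(N1 - k) = pos x o1 k.
    by move=> kN; rewrite sy /y ?leq_subr ?subKn//; lia.
  have yadd k : (k <= N2)%N -> s`_(N1 + k) = pos x o2 k.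
    move=> kN; rewrite sy ?leq_add2l// /y.
    case: k kN => [|k] kN; last by rewrite ifF ?addKn//; lia.
    by rewrite addn0 leqnn subnn !big_ord0.
  have hsA : has (fun z => `[< A z >]) s.
    apply/(has_nthP 0); exists N1; first by rewrite size_mkseq; lia.
    by apply/asboolP; rewrite sy ?leq_addr// yN1.
  have eE : entry A s = N1.
    apply/eqP; rewrite eqn_leq; apply/andP; split; rewrite leqNgt; apply/negP => lt.
      by apply: (entry_before lt); rewrite sy ?leq_addr// yN1.
    have : A s`_(entry A s) by have /asboolP := nth_find 0 hsA.
    rewrite -(subKn (ltnW lt)) ysub ?leq_subr//.
    by apply: nA; lia.
  have vs : valid_word A s.
    split=> //.
    - by rewrite -(subnn N1) ysub.
    - by rewrite lE yadd.
    - rewrite lE => k /andP[k0 kN]; have [kN1|kN1] := leqP k N1.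
        rewrite -(subKn kN1) ysub ?leq_subr//; split; first by apply: f1; lia.
        (* Before index [N1] the backward walk avoids [A], hence [K]; at [N1] the letter is [x],
           which the forward walk requires to be outside [K]. *)
        have [kN1'|Nk] := ltnP k N1; first by move=> /KA; apply: nA; lia.
        have -> : (N1 - k = 0)%N by lia.
        by have := nK 0%N isT; rewrite !big_ord0.
      rewrite -(subnKC (ltnW kN1)) yadd; last by lia.
      by split; [apply: f2; lia|apply: nK; lia].
  have ws : word_event A s (o1, o2).
    split=> //; rewrite eE ?lE ?addKn => k kN /=; rewrite sy ?leq_addr// yN1.
      by rewrite ysub.
    by rewrite yadd.
  have wE : word (pickle s) = s by rewrite /word pickleK_inv.
  exists (pickle s) => //; rewrite wE; split=> //; apply/(XE _ _ ws).
  rewrite word_event_Bwd// word_event_Fwd// eE lE addKn sy ?leq_addr// yN1.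
  by split.
- move=> n; apply: measurableI; last exact: measurable_word_event.
  by rewrite -[X in measurable X]setTI; exact: measurable_two_sided.
- move=> m n _ _ [u [[Xm wm] [Xn wn]]].
  have /(XE _ _ wm)[_ xm _] := Xm; have /(XE _ _ wn)[_ xn _] := Xn.
  have mn : word m = word n by apply: (word_event_uniq AK _ wm wn); rewrite xm xn.
  (* A valid word is nonempty, hence not the default value, and so has a single index. *)
  have [vm _ _] := wm; have [vn _ _] := wn; move: vm vn mn; rewrite /word.
  have := pickle_invK (T := seq Z2) m; have := pickle_invK (T := seq Z2) n.
  case: (pickle_inv m) => [sm|]/=; last by move=> _ _ [].
  case: (pickle_inv n) => [sn|]/=; last by move=> _ _ _ [].
  by move=> <- <- _ _ ->.
- apply: bigcupT_measurable => n; apply: measurableI; last exact: measurable_word_event.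
  by rewrite -[X in measurable X]setTI; exact: measurable_two_sided.
Qed.

Lemma QA_consistent A (B : set (Wstar R)) :
  K `<=` A -> A `<=` K' -> measurable B ->
  QA K' (@pistar R @^-1` (B `&` Wstar_enter A)) = QA A (@pistar R @^-1` B).
Proof.
move=> KA AK mB; rewrite /QA /= /mseries; apply: eq_eseriesr => n _ /=.
rewrite !QA_wordE; set s := word n.
(* For a word invalid for [A] both terms vanish: a word valid for [K'] whose trajectory enters [A]
   would have a letter in [A]. *)
have [vs|nvs] := pselect (valid_word A s); last first.
  rewrite [X in _ = PP X](_ : _ = set0); last first.
    by apply/seteqP; split=> // o [_ []].
  rewrite (_ : _ `&` _ = set0)//; apply/seteqP; split=> // o [[_ Ao] [vs _ _]].
  apply: nvs; have [_ n0 nl vk] := vs; split=> //.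
  move: Ao; rewrite (one_sided_shift o _ vs)// => /Wstar_enterE.
  exact: one_sided_enter_has.
have vs' := valid_wordS AK vs.
(* Modulo shift, both terms become events on the chronological holding times, whatever the cut. *)
have E A' B' : A' `<=` K' -> valid_word A' s ->
    two_sided A' s @^-1` (@pistar R @^-1` B') `&` word_event A' s =
    word_event A' s `&` word_holds A' s @^-1` ((@pistar R \o one_sided s) @^-1` B').
  move=> AK' v'; rewrite setIC; congr (_ `&` _); apply/seteqP.
  by split=> o /=; rewrite (one_sided_shift o AK' v').
rewrite !E//.
have -> : (@pistar R \o one_sided s) @^-1` (B `&` Wstar_enter A) =
          (@pistar R \o one_sided s) @^-1` B.
  apply/seteqP; split=> [h []//|h Bh]; split=> //.
  by apply/Wstar_enterE; exact: one_sided_enter AK vs.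
apply: word_event_law => //; rewrite -[X in measurable X]setTI.
exact: (measurableT_comp (@measurable_pistar R) (measurable_one_sided s)).
Qed.

End Words.

(** * Finiteness and uniqueness in the case A = K' *)

Section Uniqueness.
Context (R : realType) (d : measure_display) (Omega : measurableType d).
Context (P : probability Omega R).
Context (step : nat -> Omega -> Z2) (hold : nat -> Omega -> R).
Context (model : srw_model P step hold).
Context (K K' : set Z2) (finK' : finite_set K').
Context (Q : {measure set (W R) -> \bar R}) (QK' : is_QA P step hold K K' K' Q).

Local Notation W_at x := [set w : W R | sval w 0 = Some x].

Lemma is_QA_rectangle Em Ep x : K' x -> measurable Em -> measurable Ep ->
  Q (W_rectangle Em Ep `&` W_at x) =
  (backward_mass P step hold K' K' x Em * forward_mass P step hold K K' x Ep)%E.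
Proof.
move=> Kx mEm mEp; rewrite -QK'.2//; congr (Q _); apply/seteqP; split=> w.
  by move=> [[EM EP] xE]; split=> //; apply/in_sval_image; [|exact: EM| |exact: EP].
by move=> [EM xE EP]; split=> //; split; apply/in_sval_image; [|exact: EM| |exact: EP].
Qed.

Lemma is_QA_point_lty x : K' x -> (Q (W_at x) < +oo)%E.
Proof.
move=> Kx; have := @is_QA_rectangle setT setT x Kx measurableT measurableT.
rewrite /W_rectangle !preimage_setT !setTI => ->.
rewrite (backward_massE model)// (forward_massE model)//.
have mhalf m A : measurable (half_event step hold K' m A x [set: Wplus R]).
  exact: (measurable_half_event model).
apply: lte_mul_pinfty => //; first by rewrite fin_num_measure.
by rewrite (le_lt_trans (probability_le1 _ _)) ?ltry.
Qed.

(** The first clause of [is_QA] puts the position at time 0 in [K'], which is finite. *)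
Lemma is_QA_sum B : measurable B -> Q B = (\sum_(x \in K') Q (B `&` W_at x))%E.
Proof.
move=> mB; rewrite (measure_fullI (measurable_W_enter_at0 K') QK'.1 mB).
rewrite -measure_fin_bigcup//.
- rewrite -setI_bigcupr [RHS](measure_fullI (measurable_W_enter_at0 K') QK'.1).
    congr (Q _); rewrite -setIA; congr (_ `&` _); apply/esym/setIidr.
    by move=> w [[x Kx w0] _]; exists x.
  apply: measurableI => //; apply: bigcup_measurable_count => x _.
  exact: measurable_W_coord.
- by apply/trivIsetP => x y _ _ xy; apply/seteqP; split=> // w;
    move=> [[_ /= wx] [_ /=]]; rewrite wx => -[] /eqP; rewrite (negbTE xy).
- by move=> x _; apply: measurableI => //; exact: measurable_W_coord.
Qed.

Lemma is_QA_lty : (Q setT < +oo)%E.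
Proof.
rewrite is_QA_sum// fsbig_finite//= big_seq; apply: lte_sum_pinfty => x.
by rewrite in_fset_set// inE setTI; exact: is_QA_point_lty.
Qed.

End Uniqueness.

(** The product formula fixes the position at time 0, so the measures are compared after restriction
    to each [x], where the mass is at most a product of two probabilities. *)
Lemma is_QA_unique (R : realType) (d : measure_display)
    (Omega : measurableType d) (P : probability Omega R)
    (step : nat -> Omega -> Z2) (hold : nat -> Omega -> R)
    (model : srw_model P step hold) (K K' : set Z2) (finK' : finite_set K')
    (Q Q' : {measure set (W R) -> \bar R}) :
  is_QA P step hold K K' K' Q -> is_QA P step hold K K' K' Q' ->
  forall B, measurable B -> Q B = Q' B.
Proof.
move=> hQ hQ' B mB; rewrite (is_QA_sum finK' hQ)// (is_QA_sum finK' hQ')//.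
apply: eq_fsbigr => x; rewrite inE => Kx.
have mW := measurable_W_coord 0 (Some x) : measurable ([set w : W R | _]).
rewrite -[LHS]/(mrestr Q mW B) -[RHS]/(mrestr Q' mW B).
apply: W_rectangle_unique => // [|Em Ep mEm mEp].
  by rewrite /= /mrestr setTI; exact: (is_QA_point_lty model hQ).
by rewrite /= /mrestr !(is_QA_rectangle hQ, is_QA_rectangle hQ').
Qed.

(** * The image modulo shift as a finite measure *)

Section FinitePushforward.
Context (R : realType) (Q : {measure set (W R) -> \bar R}).
Context (Q_lty : (Q setT < +oo)%E).

Definition Wstar_measure : set (Wstar R) -> \bar R :=
  image_measure Q (@measurable_pistar R).

HB.instance Definition _ := Measure.on Wstar_measure.

Let Wstar_measure_fin : fin_num_fun Wstar_measure.
Proof.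
move=> B mB; rewrite ge0_fin_numE//; apply: le_lt_trans Q_lty.
by apply: (@le_measure _ _ _ Q (@pistar R @^-1` B) setT); rewrite ?inE.
Qed.

HB.instance Definition _ :=
  Measure_isFinite.Build _ _ _ Wstar_measure Wstar_measure_fin.

Definition Wstar_finite_measure : {finite_measure set (Wstar R) -> \bar R} :=
  Wstar_measure.

End FinitePushforward.

(* The equations do not constrain nu on trajectories avoiding K', so nu is taken
   to be carried by the trajectories entering K'. *)
Theorem theorem2p3 (R : realType) (d : measure_display)
    (Omega : measurableType d) (P : probability Omega R)
    (step : nat -> Omega -> Z2) (hold : nat -> Omega -> R)
    (model : srw_model P step hold)
    (K K' : set Z2) (KK' : K `<=` K') (finK' : finite_set K') :
  exists nu : {finite_measure set (Wstar R) -> \bar R},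
    [/\ nu (~` Wstar_enter K') = 0%E,
        interlacement_eq P step hold K K' nu &
        forall mu : {finite_measure set (Wstar R) -> \bar R},
          mu (~` Wstar_enter K') = 0%E ->
          interlacement_eq P step hold K K' mu ->
          forall B : set (Wstar R), measurable B -> mu B = nu B].
Proof.
have QK' := QA_is_QA model KK' (@subset_refl _ K').
have Qfin := is_QA_lty model finK' QK'.
exists (Wstar_finite_measure Qfin).
have nuE B :
  Wstar_finite_measure Qfin B = QA model K K' K' (@pistar R @^-1` B) by [].
split.
- rewrite nuE (_ : _ @^-1` _ = ~` @W_enter R K'); last first.
    by rewrite -(@pistar_preimage_enter R K').
  apply: (subset_measure0 _ _ _ QK'.1).
  + exact: measurableC (@measurable_W_enter R K').
  + exact: measurableC (@measurable_W_enter_at0 R K').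
  + by apply: subsetC => w [Kw0 _]; exists (0 : R).
- move=> A KA AK'; exists (QA model K K' A); split; first exact: QA_is_QA.
  by move=> B mB; rewrite nuE QA_consistent.
- move=> mu mu0 mueq B mB.
  have [Q [hQ muE]] := mueq K' KK' (@subset_refl _ K').
  apply: etrans (measure_fullI (@measurable_Wstar_enter R K') mu0 mB) _.
  apply: etrans (muE B mB) _; rewrite nuE.
  exact: (is_QA_unique model finK' hQ QK').
Qed.
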